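(* Let $G$ be a finitely generated nilpotent group and $\pi$ a (possibly infinite-dimensional) irreducible representation of $G$ over an arbitrary field $K$. Suppose that there are a subgroup $H'\subset G$ and a finite-dimensional irreducible representation $\rho'$ of $H'$ over $K$ such that the vector space $\operatorname{Hom}_{H'}(\rho',\pi|_{H'})$ is non-zero and finite-dimensional over $K$. Then there are a subgroup $H\subset G$ and a finite-dimensional irreducible representation $\rho$ of $H$ over $K$ such that $\pi$ is isomorphic to the finitely induced representation $\operatorname{ind}_H^G(\rho)$.
   Context: Representations are on $K$-vector spaces without any topological structure. No assumption is made on $K$ (it may be non-algebraically closed or of positive characteristic). Finitely induced representation: for a subgroup $H\subset G$ and a representation $\rho$ of $H$ on a vector space $V$, $\operatorname{ind}_H^G(\rho)$ is the space of all functions $f\colon G\to V$ such that $f(hg)=\rho(h)f(g)$ for all $h\in H$, $g\in G$, and such that the support of $f$ is a union of finitely many right cosets $Hg$; $G$ acts by right translations, $(g_0f)(x)=f(xg_0)$. *)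

(* Defs.v *)
From HB Require Import structures.
From mathcomp Require Import all_boot all_algebra.
From mathcomp Require Import boolp classical_sets functions cardinality.

Set Implicit Arguments.
Unset Strict Implicit.
Unset Printing Implicit Defensive.

Import GRing.Theory.

Local Open Scope classical_set_scope.
Local Open Scope ring_scope.

Definition is_subgroup (G : groupType) (H : set G) : Prop := group_closed [in H].

Record subgroup (G : groupType) := Subgroup {
  subgroup_set :> G -> Prop;
  subgroupP : is_subgroup subgroup_set }.

Lemma is_subgroupT (G : groupType) : is_subgroup [set: G].
Proof. by split=> [|x y _ _]; rewrite !inE. Qed.

Definition subgroupT (G : groupType) : subgroup G := Subgroup (is_subgroupT G).

Section SubgroupTheory.
Variables (G : groupType) (H : subgroup G).

Lemma subgroup1 : H 1%g.
Proof. by case: (subgroupP H) => + _; rewrite !inE. Qed.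

Lemma subgroupV x : H x -> H x^-1%g.
Proof.
move=> Hx; have := group_closedV (subgroupP H) (x := x).
by rewrite !inE; apply.
Qed.

Lemma subgroupM x y : H x -> H y -> H (x * y)%g.
Proof.
move=> Hx Hy; have := group_closedM (subgroupP H) (x := x) (y := y).
by rewrite !inE; apply.
Qed.

End SubgroupTheory.

Definition subgroup_generated (G : groupType) (A : set G) : set G :=
  smallest (@is_subgroup G) A.

Definition finitely_generated (G : groupType) : Prop :=
  exists2 A : set G, finite_set A & subgroup_generated A = [set: G].

Fixpoint lower_central (G : groupType) (n : nat) : set G :=
  if n is m.+1 then
    subgroup_generated [set [~ x, y]%g | x in lower_central m & y in [set: G]]
  else [set: G].
Arguments lower_central : clear implicits.

Definition nilpotent_group (G : groupType) : Prop :=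
  exists n, lower_central G n = [set 1%g].

Definition right_coset (G : groupType) (H : set G) (g : G) : set G :=
  [set (h * g)%g | h in H].

(* As for mx_representation, the action is a function on all of G, but only   *)
(* its values on H are constrained, and only these are meaningful.            *)
Record representation (G : groupType) (H : subgroup G)
    (K : fieldType) (V : lmodType K) := Representation {
  repr_act :> G -> {linear V -> V};
  repr_act1 : forall v, repr_act 1%g v = v;
  repr_actM : forall g h, H g -> H h ->
    forall v, repr_act (g * h)%g v = repr_act g (repr_act h v) }.

Section Representations.
Variables (G : groupType) (K : fieldType).

Definition irreducible (H : subgroup G) (V : lmodType K)
    (rho : representation H V) : Prop :=
  (exists v : V, v != 0) /\
  forall U : set V, submod_closed [in U] ->
    (forall h, H h -> forall v, U v -> U (rho h v)) ->
    U = [set 0] \/ U = [set: V].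

Definition isomorphic (H : subgroup G) (V W : lmodType K)
    (rho : representation H V) (sigma : representation H W) : Prop :=
  exists2 phi : {linear V -> W}, bijective phi &
    forall h, H h -> forall v, phi (rho h v) = sigma h (phi v).

Definition restriction (V : lmodType K) (pi : representation (subgroupT G) V)
    (H : subgroup G) : representation H V :=
  @Representation G H K V pi (repr_act1 pi) (fun g h _ _ => repr_actM pi I I).

Definition rep_hom (H : subgroup G) (V W : lmodType K)
    (rho : representation H V) (sigma : representation H W) : set (V -> W) :=
  [set f | linear f /\
    forall h, H h -> forall v, f (rho h v) = sigma h (f v)].

End Representations.

(* Finite-dimensionality of a subspace S of a possibly infinite-dimensional   *)
(* space (spaces which are finite-dimensional as a whole are in vectType).    *)
Definition finite_dimensional (K : fieldType) (E : lmodType K) (S : set E) :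
    Prop :=
  exists (n : nat) (e : 'I_n -> E),
    S = [set \sum_(i < n) c i *: e i | c in [set: 'I_n -> K]].

Section InducedRepresentation.
Variables (G : groupType) (H : subgroup G) (K : fieldType) (V : lmodType K).
Variable rho : representation H V.

Definition ind_set : set (G -> V) :=
  [set f | (forall h, H h -> forall g, f (h * g)%g = rho h (f g)) /\
    exists2 A : set G, finite_set A &
      [set g | f g != 0] = \bigcup_(a in A) right_coset H a].

Lemma repr_act_eq0 h v : H h -> (rho h v == 0) = (v == 0).
Proof.
move=> Hh; apply/eqP/eqP => [rv0|->]; last exact: linear0.
by rewrite -[v](repr_act1 rho) -(mulVg h) repr_actM ?rv0 ?linear0//;
  exact: subgroupV.
Qed.

(* For an equivariant f, being supported in finitely many cosets is enough.   *)
Lemma ind_setP (f : G -> V) (A : set G) :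
    (forall h, H h -> forall g, f (h * g)%g = rho h (f g)) ->
    finite_set A ->
    (forall g, f g != 0 -> exists2 a, A a & right_coset H a g) ->
  ind_set f.
Proof.
move=> fH finA suppf; split=> //; exists (A `&` [set a | f a != 0]).
  exact: finite_setIl.
apply/seteqP; split=> [g /= fg|g [a [/= _ fa] [h Hh <-]]]; last first.
  by rewrite /= fH// repr_act_eq0.
have [a Aa [h Hh hag]] := suppf g fg; exists a; last by exists h.
by split=> //=; move: fg; rewrite -hag fH// repr_act_eq0.
Qed.

Definition ind_pred : {pred G -> V} := [in ind_set].

Fact ind_submod_closed : submod_closed ind_pred.
Proof.
split=> [|k f g]; rewrite !inE /=.
  apply: (@ind_setP _ set0) => [h Hh g||g]; [|exact: finite_set0|].
    by rewrite linear0.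
  by rewrite eqxx.
move=> [fH [A finA fA]] [gH [B finB gB]].
apply: (@ind_setP _ (A `|` B)) => [h Hh x||x fgx].
- by rewrite /= !fctE fH// gH// linearP.
- by rewrite finite_setU.
have [fx|fx] := eqVneq (f x) 0; last first.
  have : [set g | f g != 0] x by [].
  by rewrite fA => -[a Aa xa]; exists a => //; left.
have : [set y | g y != 0] x.
  by apply: contraNN fgx => /eqP gx; rewrite !fctE fx gx scaler0 addr0.
by rewrite gB => -[a Ba xa]; exists a => //; right.
Qed.

HB.instance Definition _ :=
  GRing.isSubmodClosed.Build K (G -> V) ind_pred ind_submod_closed.

Record ind_space := IndSpace {
  ind_fun :> G -> V;
  ind_funP : ind_fun \in ind_pred }.

HB.instance Definition _ := [isSub for ind_fun].
HB.instance Definition _ := [Choice of ind_space by <:].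
HB.instance Definition _ := [SubChoice_isSubLmodule of ind_space by <:].

Fact ind_act_subproof (g0 : G) (f : ind_space) :
  (fun x => f (x * g0)%g) \in ind_pred.
Proof.
have := ind_funP f; rewrite !inE => -[fH [A finA fA]].
apply: (@ind_setP _ [set (a * g0^-1)%g | a in A]) => [h Hh g||g fg].
- by rewrite -mulgA; exact: fH.
- exact: (finite_image _ finA).
have : [set x | f x != 0] (g * g0)%g by [].
rewrite fA => -[a Aa [h Hh hag]]; exists (a * g0^-1)%g; first by exists a.
by exists h => //; rewrite mulgA hag mulgK.
Qed.

Definition ind_act (g0 : G) (f : ind_space) : ind_space :=
  IndSpace (ind_act_subproof g0 f).

Fact ind_act_linear g0 : linear (ind_act g0).
Proof. by move=> k f g; apply/val_inj. Qed.

HB.instance Definition _ g0 :=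
  GRing.isLinear.Build K ind_space ind_space _ (ind_act g0) (ind_act_linear g0).

Fact ind_act1 f : ind_act 1%g f = f.
Proof. by apply/val_inj/funext => x /=; rewrite mulg1. Qed.

Fact ind_actM g h : subgroupT G g -> subgroupT G h ->
  forall f, ind_act (g * h)%g f = ind_act g (ind_act h f).
Proof. by move=> _ _ f; apply/val_inj/funext => x /=; rewrite mulgA. Qed.

Definition ind : representation (subgroupT G) ind_space :=
  @Representation G (subgroupT G) K ind_space ind_act ind_act1 ind_actM.

End InducedRepresentation.

(* Main.v *)
(* A finitely generated nilpotent group is noetherian, so we can choose H     *)
(* maximal among the subgroups carrying a finite-dimensional irreducible rho  *)
(* with Hom_H(rho, pi) nonzero and finite-dimensional. If F is a finite sum   *)
(* of translates under N(H) of the rho-isotypic part of pi, then the          *)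
(* stabilizer of F again carries such a representation, hence lies in H by    *)
(* maximality. Consequently N(H)/H is torsion-free, so that H is isolated by  *)
(* nilpotency, and an element of N(H) fixing the class of rho lies in H. By a *)
(* Mackey argument every H-homomorphism from rho to ind rho then takes its    *)
(* values in the functions supported on H. Irreducibility of ind rho follows  *)
(* by climbing the chain of iterated normalizers of H, which reaches G, and   *)
(* Frobenius reciprocity provides a nonzero homomorphism from ind rho to pi.  *)

From HB Require Import structures.
Require Import Defs.
From mathcomp Require Import all_boot all_algebra.
From mathcomp Require Import boolp classical_sets functions cardinality fsbigop.

Set Implicit Arguments.
Unset Strict Implicit.
Unset Printing Implicit Defensive.

Import GRing.Theory.

Local Open Scope classical_set_scope.
(** * Subgroups and the lower central series *)

(** Choose [H] maximal among the [admissible] subgroups, those satisfying the hypothesis on H'; it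
    exists because the group is noetherian ([fg_nilpotent_noetherian], [noetherian_max]). A nonzero
    homomorphism from [rho] to [pi] yields a nonzero one from [ind rho] to [pi], which is an
    isomorphism as soon as [ind rho] is irreducible ([irreducible_ind_isomorphic]).

    Maximality acts through [admissible_stabilizer]: if Q is a finite sum of N(H)-translates of the
    images of the homomorphisms from [rho] to [pi], its stabilizer is admissible and contains [H],
    so it is [H]. An element of N(H) preserving some such Q is therefore in [H]. This applies to
    elements with a positive power in [H] and to those whose conjugate of [rho] is isomorphic to
    [rho] ([admissible_max_normalizer]). By nilpotency, [H] is then closed under roots in the whole
    group ([nilpotent_isolated]).

    These properties show that homomorphisms from [rho] to [ind rho] take values in functions
    supported on [H] ([mackey_support]). Such control of intertwiners does not by itself give
    irreducibility; [absorbing_normalizer] obtains it along the chain of iterated normalizers of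
    [H], by an argument on minimal supports. *)

Section Subgroups.
Local Open Scope group_scope.
Variable G : groupType.
Implicit Types (A : set G) (B H K M N P : subgroup G) (u v x y z : G).

Lemma is_subgroupI A : A 1 -> (forall x y, A x -> A y -> A (x * y)) ->
  (forall x, A x -> A x^-1) -> is_subgroup A.
Proof.
by move=> A1 AM AV; split=> [|x y]; rewrite !inE// => Ax /AV; apply: AM.
Qed.

Fact gen_subgroup_subproof A : is_subgroup (subgroup_generated A).
Proof.
apply: is_subgroupI => [B [gB _]|x y Ax Ay B BA|x Ax B BA].
- exact: (subgroup1 (Subgroup gB)).
- by have [gB _] := BA; apply: (@subgroupM _ (Subgroup gB)); [exact: Ax|exact: Ay].
- by have [gB _] := BA; apply: (@subgroupV _ (Subgroup gB)); exact: Ax.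
Qed.

Definition gen A : subgroup G := Subgroup (gen_subgroup_subproof A).

Lemma mem_gen A x : A x -> gen A x.
Proof. exact: sub_gen_smallest. Qed.

Lemma gen_sub A B : A `<=` B -> gen A `<=` B.
Proof. by move=> AB; apply: smallest_sub => //; exact: subgroupP. Qed.

Lemma genS A A' : A `<=` A' -> gen A `<=` gen A'.
Proof. by move=> AA'; apply: gen_sub => x /AA'; exact: mem_gen. Qed.

Lemma subgroupX H x n : H x -> H (x ^+ n).
Proof.
move=> Hx; elim: n => [|n IH]; first exact: subgroup1.
by rewrite expgS; apply: subgroupM.
Qed.

Lemma subgroupJ H x y : H x -> H y -> H (x ^ y).
Proof.
by move=> Hx Hy; apply: subgroupM; [exact: subgroupV|exact: subgroupM].
Qed.

Lemma subgroupR H x y : H x -> H y -> H [~ x, y].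
Proof.
by move=> Hx Hy; apply: subgroupM; [exact: subgroupV|exact: subgroupJ].
Qed.

Fact subgroupI_subproof H K : is_subgroup (H `&` K).
Proof.
by apply: is_subgroupI => [|x y [? ?] [? ?]|x [? ?]]; split;
  solve [exact: subgroup1 | exact: subgroupM | exact: subgroupV].
Qed.

Definition subgroupI H K : subgroup G := Subgroup (subgroupI_subproof H K).

Fact normalizer_subproof H :
  is_subgroup [set x | forall h, (H h -> H (h ^ x)) /\ (H h -> H (h ^ x^-1))].
Proof.
apply: is_subgroupI => [h|x y Nx Ny h|x Nx h] /=.
- by rewrite invg1 conjg1.
- rewrite invgM !conjgM; split=> Hh.
    by apply: (Ny _).1; apply: (Nx _).1.
  by apply: (Nx _).2; apply: (Ny _).2.
- by rewrite invgK; split=> Hh; [exact: (Nx _).2|exact: (Nx _).1].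
Qed.

Definition normalizer H : subgroup G := Subgroup (normalizer_subproof H).

Lemma subgroup_normalizer H : H `<=` normalizer H.
Proof.
by move=> x Hx h; split=> Hh; apply: subgroupJ => //; exact: subgroupV.
Qed.

Lemma commMg x y z : [~ x * y, z] = [~ x, z] ^ y * [~ y, z].
Proof. by rewrite /commg /conjg !gnorm. Qed.

Lemma commgM x y z : [~ x, y * z] = [~ x, z] * [~ x, y] ^ z.
Proof. by rewrite /commg /conjg !gnorm. Qed.

Lemma commVg x y : [~ x^-1, y] = ([~ x, y] ^ x^-1)^-1.
Proof. by rewrite /commg /conjg !gnorm. Qed.

Lemma commgV x y : [~ x, y^-1] = ([~ x, y] ^ y^-1)^-1.
Proof. by rewrite /commg /conjg !gnorm. Qed.

Lemma conjg_comm x y : x ^ y = x * [~ x, y].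
Proof. by rewrite /commg mulVKg. Qed.

Fixpoint lcs P k : subgroup G :=
  if k is m.+1 then gen [set [~ x, y] | x in lcs P m & y in P] else P.

Lemma lcsT k : lcs (subgroupT G) k = lower_central G k :> set G.
Proof. by elim: k => //= k ->. Qed.

Lemma lcsR P k x y : lcs P k x -> P y -> lcs P k.+1 [~ x, y].
Proof. by move=> Px Py; apply: mem_gen; exists x => //; exists y. Qed.

Lemma lcsRl P k x y : lcs P k x -> P y -> lcs P k.+1 [~ y, x].
Proof. by move=> Px Py; rewrite -invgR; apply: subgroupV; exact: lcsR. Qed.

Lemma lcsJ P k x y : lcs P k x -> P y -> lcs P k (x ^ y).
Proof.
elim: k x y => [|k IH] x y; first exact: subgroupJ.
move=> kx Py; pose A := [set z | lcs P k.+1 (z ^ y)].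
have sA : is_subgroup A.
  apply: is_subgroupI => [|z t|z]; rewrite /A /mkset.
  - by rewrite conj1g; exact: subgroup1.
  - by rewrite conjMg; exact: subgroupM.
  - by rewrite conjVg; exact: subgroupV.
apply: (@gen_sub _ (Subgroup sA) _ _ kx) => _ [z kz [t Pt <-]].
by rewrite /= /A /mkset conjRg; apply: lcsR; [exact: IH|exact: subgroupJ].
Qed.

Lemma lcsS P k : lcs P k.+1 `<=` lcs P k.
Proof.
apply: gen_sub => _ [x kx [y Py <-]].
by apply: subgroupM; [exact: subgroupV|exact: lcsJ].
Qed.

Lemma lcs_sub P k : lcs P k `<=` P.
Proof. by elim: k => // k IH; apply: subset_trans IH; exact: lcsS. Qed.

Lemma lcs_leq P c k : (c <= k)%N -> lcs P k `<=` lcs P c.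
Proof.
by move=> /subnK <-; elim: (k - c)%N => // n IH; apply: subset_trans IH; exact: lcsS.
Qed.

Lemma lcs_mono P K k : P `<=` K -> lcs P k `<=` lcs K k.
Proof.
move=> PK; elim: k => //= k IH.
apply: genS => _ [x kx [y Py <-]]; exists x; first exact: IH.
by exists y => //; exact: PK.
Qed.

Section CommutatorPreimage.
Variables (P B : subgroup G) (k : nat).
Hypotheses (BP : B `<=` lcs P k.+1) (PB : lcs P k.+2 `<=` B).

Let BJ x y : B x -> P y -> B (x ^ y).
Proof.
move=> Bx Py; rewrite conjg_comm; apply: subgroupM => //.
by apply: PB; apply: lcsR => //; exact: BP.
Qed.

(** Commutation is bilinear from [lcs P k] and [P] to the factor of [lcs P k.+1] by [lcs P k.+2], so
    preimages of [B] in either variable are subgroups. *)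
Lemma commgr_subgroup u : lcs P k u -> is_subgroup [set x | P x /\ B [~ u, x]].
Proof.
move=> ku; apply: is_subgroupI => [|x y [Px Bx] [Py By]|x [Px Bx]].
- by split; [exact: subgroup1|rewrite commg1; exact: subgroup1].
- split; first exact: subgroupM.
  by rewrite commgM; apply: subgroupM => //; exact: BJ.
- split; first exact: subgroupV.
  by rewrite commgV; apply: subgroupV; apply: BJ => //; exact: subgroupV.
Qed.

Lemma commgl_subgroup x : P x -> is_subgroup [set u | lcs P k u /\ B [~ u, x]].
Proof.
move=> Px; apply: is_subgroupI => [|u v [ku Bu] [kv Bv]|u [ku Bu]].
- by split; [exact: subgroup1|rewrite comm1g; exact: subgroup1].
- split; first exact: subgroupM.
  by rewrite commMg; apply: subgroupM => //; apply: BJ => //; exact: lcs_sub kv.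
- split; first exact: subgroupV.
  rewrite commVg; apply: subgroupV; apply: BJ => //; apply: subgroupV.
  exact: lcs_sub ku.
Qed.

End CommutatorPreimage.

(** The same bilinearity: powers leave the commutator up to an error in [lcs P k.+2]. *)
Lemma commgX P k u x n : lcs P k u -> P x ->
  exists2 c, lcs P k.+2 c & [~ u, x ^+ n] = [~ u, x] ^+ n * c.
Proof.
move=> ku Px; have k1 := lcsR ku Px.
elim: n => [|n [c kc IH]]; first by exists 1; [exact: subgroup1|rewrite commg1 mulg1].
exists (c * [~ [~ u, x] ^+ n * c, x]).
  apply: subgroupM => //; apply: lcsR => //.
  by apply: subgroupM; [exact: subgroupX|exact: lcsS].
by rewrite expgSr commgM IH conjg_comm expgS !mulgA.
Qed.

Lemma commXg P k u x n : lcs P k u -> P x ->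
  exists2 c, lcs P k.+2 c & [~ u ^+ n, x] = [~ u, x] ^+ n * c.
Proof.
move=> ku Px; have k1 := lcsR ku Px.
elim: n => [|n [c kc IH]]; first by exists 1; [exact: subgroup1|rewrite comm1g mulg1].
exists ((c * [~ [~ u, x] ^+ n * c, u]) ^ [~ u, x]).
  apply: lcsJ; last exact: lcs_sub k1.
  apply: subgroupM => //; apply: lcsR; last exact: lcs_sub ku.
  by apply: subgroupM; [exact: subgroupX|exact: lcsS].
rewrite expgSr commMg IH conjg_comm expgSr -[in RHS]mulgA -conjgC.
by rewrite !mulgA.
Qed.

(** * Roots of elements of a subgroup in a nilpotent group *)

Definition isolator H : set G := [set x | exists2 n, 0 < n & H (x ^+ n)].

(** The quotient of [C] by [B] is abelian, and the torsion elements of an abelian group form a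
    subgroup. *)
Lemma isolator_subgroup (C B : subgroup G) : B `<=` C ->
  (forall x y, C x -> C y -> B [~ x, y]) -> is_subgroup (C `&` isolator B).
Proof.
move=> BC CB.
have BJ x y : B x -> C y -> B (x ^ y).
  by move=> Bx Cy; rewrite conjg_comm; apply: subgroupM => //; apply: CB => //;
    exact: BC.
have powM x y n : C x -> C y ->
    exists2 c, B c & (x * y) ^+ n = x ^+ n * y ^+ n * c.
  move=> Cx Cy; elim: n => [|n [c Bc IH]].
    by exists 1; [exact: subgroup1|rewrite !mulg1].
  exists ([~ y ^+ n, x] ^ y * c ^ (x * y)).
    by apply: subgroupM; apply: BJ => //; [apply: CB => //;
      exact: subgroupX|exact: subgroupM].
  rewrite 3!expgSr IH -!mulgA; congr (_ * _).
  by rewrite /commg /conjg !gnorm.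
apply: is_subgroupI => [|x y [Cx [n n0 Bx]] [Cy [m m0 By]]|x [Cx [n n0 Bx]]].
- by split; [|exists 1%N]; rewrite ?expg1; try exact: subgroup1.
- split; first exact: subgroupM.
  exists (n * m)%N; first by rewrite muln_gt0 n0.
  have [c Bc ->] := powM x y (n * m)%N Cx Cy.
  apply: subgroupM => //; apply: subgroupM; first by rewrite expgnA; exact: subgroupX.
  by rewrite mulnC expgnA; exact: subgroupX.
- split; first exact: subgroupV.
  by exists n => //; rewrite expVgn; exact: subgroupV.
Qed.

(* The k-th factor of the lower central series of P = <H, x> consists of      *)
(* torsion elements modulo H; hence, by descending induction on k, the terms  *)
(* of the series normalize H and lie in H.                                    *)
Lemma nilpotent_isolated H x : nilpotent_group G ->
    (forall y, normalizer H y -> isolator H y -> H y) ->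
  isolator H x -> H x.
Proof.
move=> [c Gc1] HN Hx; pose P := gen (H `|` [set x]).
have HP : H `<=` P by move=> h Hh; apply: mem_gen; left.
have Px : P x by apply: mem_gen; right.
pose B k := gen ((H `&` lcs P k) `|` lcs P k.+1).
have BP k : B k `<=` lcs P k.
  by apply: gen_sub => y [[]//|]; exact: lcsS.
have PB k : lcs P k.+1 `<=` B k by move=> y Py; apply: mem_gen; right.
have rootsB k : lcs P k `<=` isolator (B k).
  elim: k => [|k IH].
    have sE : is_subgroup (P `&` isolator (B 0)).
      apply: isolator_subgroup => [|y z Py Pz]; first exact: BP.
      by apply: PB; exact: lcsR.
    apply: subset_trans (@subIsetr _ P _).
    apply: (@gen_sub _ (Subgroup sE)) => y [Hy|->]; split=> //; first exact: HP.
      by exists 1%N => //; apply: mem_gen; left; split=> //; exact: HP.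
    have [n n0 Hxn] := Hx; exists n => //.
    by apply: mem_gen; left; split=> //; exact: HP.
  have sE : is_subgroup (lcs P k.+1 `&` isolator (B k.+1)).
    apply: isolator_subgroup => [|y z Py Pz]; first exact: BP.
    by apply: PB; apply: lcsR => //; exact: lcs_sub Pz.
  set E := Subgroup sE.
  have EP : E `<=` lcs P k.+1 by move=> y [].
  have PE : lcs P k.+2 `<=` E.
    by move=> y Py; split; [exact: lcsS|exists 1%N => //; exact: PB].
  have rootE y : lcs P k.+1 y -> isolator E y -> E y.
    move=> Py [n n0 [_ [m m0]]]; rewrite -expgnA => Bnm; split=> //.
    by exists (n * m)%N => //; rewrite muln_gt0 n0.
  (* It is enough to let [p] be in [H] or equal to [x]. In the latter case the n-th power of the
     commutator agrees, modulo [lcs P k.+2], with the commutator of [u] and [x ^+ n], where [x ^+ n]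
     is in [H]; and [E] absorbs roots. *)
  have HPE u p : H u -> lcs P k u -> P p -> E [~ u, p].
    move=> Hu ku; set F := Subgroup (commgr_subgroup EP PE ku).
    suff PF : P `<=` F by move=> /PF [].
    have HF h : H h -> F h.
      move=> Hh; split; first exact: HP.
      have kuh : lcs P k.+1 [~ u, h] by apply: lcsR => //; exact: HP.
      split=> //; exists 1%N => //; apply: mem_gen; left; split=> //.
      exact: subgroupR.
    apply: gen_sub => y [/HF//|->]; split=> //; apply: rootE; first exact: lcsR.
    have [n n0 /HF [_ Ed]] := Hx; exists n => //.
    have [d kd eq_n] := commgX n ku Px; move: Ed; rewrite eq_n => Ed.
    by rewrite -[X in E X](mulgK d); apply: subgroupM => //; apply: subgroupV;
      exact: (PE _ kd).
  (* By induction a power of [u] lies in [B k], whose generators are covered by [HPE] or have their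
     commutators in [lcs P k.+2]; roots are extracted as before. *)
  have PPE u p : lcs P k u -> P p -> E [~ u, p].
    move=> ku Pp; have [n n0 Bu] := IH u ku.
    set F := Subgroup (commgl_subgroup EP PE Pp).
    suff BF : B k `<=` F.
      have [_ Fu] := BF _ Bu; apply: rootE; first exact: lcsR.
      exists n => //; have [d kd eq_n] := commXg n ku Pp; move: Fu; rewrite eq_n => Ed.
      by rewrite -[X in E X](mulgK d); apply: subgroupM => //; apply: subgroupV;
        exact: (PE _ kd).
    apply: gen_sub => y [[Hy ky]|ky]; split=> //; first exact: HPE.
      exact: lcsS.
    by apply: (PE _); exact: lcsR.
  apply: subset_trans (@subIsetr _ (lcs P k.+1) _).
  by apply: (@gen_sub _ E) => _ [u ku [p Pp <-]]; exact: PPE.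
have lcsH j k : (c <= j + k)%N -> lcs P k `<=` H.
  elim: j k => [|j IH] k; rewrite ?add0n => ck u ku.
    have kc : lcs P c u by exact: lcs_leq ku.
    have : lower_central G c u by rewrite -lcsT; apply: lcs_mono kc.
    by rewrite Gc1 => ->; exact: subgroup1.
  have k1H : lcs P k.+1 `<=` H by apply: IH; rewrite addnS -addSn.
  have BH : B k `<=` H by apply: gen_sub => y [[]//|/k1H].
  apply: HN; last by have [n n0 /BH] := rootsB k u ku; exists n.
  have Pu := lcs_sub ku.
  by move=> h; split=> Hh; rewrite conjg_comm; apply: subgroupM => //; apply: k1H;
    apply: lcsRl; [ | exact: HP | exact: subgroupV | exact: HP].
by apply: (lcsH c 0%N); rewrite ?addn0.
Qed.
End Subgroups.

(** * Noetherian groups *)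

Section Noetherian.
Local Open Scope group_scope.
Variable G : groupType.
Implicit Types (A : set G) (B H K M N P : subgroup G) (u v x y z : G).

Definition noetherian M :=
  forall H, H `<=` M -> exists s : seq G, H = gen [set` s] :> set G.

Lemma normalizerX H x n : normalizer H x -> normalizer H (x ^+ n).
Proof. exact: subgroupX. Qed.

(** By Euclidean division, [H] is generated by its intersection with [N] and, if [H] is not inside
    [N] up to exponent zero, one element with the least positive exponent of [x]. *)
Lemma noetherian_cyclic_ext N x : noetherian N -> normalizer N x ->
  noetherian (gen (N `|` [set x])).
Proof.
move=> noethN Nx H HM.
have NJ n y : N y -> N (y ^ (x ^+ n)) by move/((normalizerX n Nx y).1).
have NJV n y : N y -> N (y ^ (x ^- n)) by move/((normalizerX n Nx y).2).
(* Exponents are natural numbers; the power of [x] on the left allows negative ones. *)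
have sA : is_subgroup [set m | exists a b n, N n /\ x ^+ a * m = x ^+ b * n].
  apply: is_subgroupI => [|m m' [a [b [n [Nn eqm]]]] [a' [b' [n' [Nn' eqm']]]]|].
  - by exists 0%N, 0%N, 1; split; [exact: subgroup1|rewrite !mulg1].
  - exists (a + a')%N, (b + b')%N, ((n ^ (x ^- a')) ^ (x ^+ b') * n').
    split; first by apply: subgroupM => //; apply: NJ; exact: NJV.
    have -> : x ^+ (a + a') * (m * m') = x ^+ a' * (x ^+ a * m) * m'.
      by rewrite addnC expgnDr !mulgA.
    have -> : m' = x ^- a' * (x ^+ b' * n') by rewrite -eqm' mulKg.
    rewrite eqm /conjg invgK expgnDr !mulgA mulgK -!expgnDr; congr (_ * _).
    by rewrite addnC.
  - move=> m [a [b [n [Nn eqm]]]]; exists b, a, ((n^-1 ^ (x ^- b)) ^ (x ^+ a)).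
    split; first by apply: NJ; apply: NJV; exact: subgroupV.
    have -> : m = x ^- a * (x ^+ b * n) by rewrite -eqm mulKg.
    by rewrite /conjg !gnorm.
have AM h : H h -> exists a b n, N n /\ x ^+ a * h = x ^+ b * n.
  move=> /HM; apply: (@gen_sub _ _ (Subgroup sA)) => y [Ny|->].
    by exists 0%N, 0%N, y; rewrite mul1g.
  by exists 0%N, 1%N, 1; split; [exact: subgroup1|rewrite mul1g mulg1 expg1].
have HA h : H h -> exists d n, N n /\ (h = x ^+ d * n \/ h^-1 = x ^+ d * n).
  move=> /AM [a [b [n [Nn eqh]]]]; have [ab|/ltnW ba] := leqP a b.
    exists (b - a)%N, n; split=> //; left; apply: (@mulgI _ (x ^+ a)).
    by rewrite eqh mulgA -expgnDr subnKC.
  exists (a - b)%N, (n^-1 ^ (x ^+ (a - b))); split; first by apply: NJ;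
    exact: subgroupV.
  right; rewrite /conjg mulVKg.
  have -> : h = x ^- a * (x ^+ b * n) by rewrite -eqh mulKg.
  by rewrite -[in LHS](subnKC ba) expgnDr !gnorm.
have [s Hs] : exists s : seq G, (H `&` N = gen [set` s] :> set G).
  by apply: (noethN (subgroupI H N)) => y [].
have [noD|] := pselect (forall d n, N n -> H (x ^+ d * n) -> d = 0%N).
  exists s; rewrite -Hs; apply/seteqP; split=> [h Hh|h []//]; split=> //.
  have [d [n [Nn [eqh|eqh]]]] := HA h Hh.
    by move: Hh; rewrite eqh => /(noD _ _ Nn) ->; rewrite mul1g.
  rewrite -[h]invgK; apply: subgroupV; have : H h^-1 by exact: subgroupV.
  by rewrite eqh => /(noD _ _ Nn) ->; rewrite mul1g.
move=> /existsNP [d /existsNP [n /not_implyP [Nn /not_implyP [Hdn /eqP d_neq0]]]].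
pose D d := `[< 0 < d /\ exists2 n, N n & H (x ^+ d * n) >].
have exD : exists d, D d by exists d; apply/asboolP; rewrite lt0n; split=> //; exists n.
case: (ex_minnP exD) => d0 /asboolP[d0_gt0 [n0 Nn0 Hd0]] min_d0.
set h0 := x ^+ d0 * n0 in Hd0.
exists (h0 :: s); apply/seteqP; split; last first.
  apply: gen_sub => y /=; rewrite inE => /predU1P[->//|ys].
  have : gen [set` s] y by exact: mem_gen.
  by rewrite -Hs => -[].
set K := gen _; have Kh0 : K h0 by apply: mem_gen; rewrite /= inE eqxx.
have HNK y : H y -> N y -> K y.
  move=> Hy Ny; have : (H `&` N) y by [].
  by rewrite Hs; apply: genS => z /= zs; rewrite inE zs orbT.
have pos e : forall m, N m -> H (x ^+ e * m) -> K (x ^+ e * m).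
  elim/ltn_ind: e => -[_ m Nm|e IH m Nm He].
    by rewrite mul1g => Hm; exact: HNK.
  have le_d0 : d0 <= e.+1 by apply: min_d0; apply/asboolP; split=> //; exists m.
  have Nm' : N (n0^-1 ^ (x ^+ (e.+1 - d0)) * m).
    by apply: subgroupM => //; apply: NJ; exact: subgroupV.
  have eqe : x ^+ e.+1 * m = h0 * (x ^+ (e.+1 - d0) * (n0^-1 ^ (x ^+ (e.+1 - d0)) * m)).
    rewrite /h0 /conjg !mulgA; congr (_ * m); rewrite -[in LHS](subnKC le_d0).
    by rewrite expgnDr !gnorm.
  rewrite eqe; apply: subgroupM => //; apply: IH => //.
    by rewrite ltn_subrL d0_gt0.
  by rewrite -(mulKg h0 (_ * _)) -eqe; apply: subgroupM => //; exact: subgroupV.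
move=> h Hh; have [e [m [Nm [eqh|eqh]]]] := HA h Hh.
  by rewrite eqh; apply: pos => //; rewrite -eqh.
rewrite -[h]invgK; apply: subgroupV; rewrite eqh; apply: pos => //.
by rewrite -eqh; exact: subgroupV.
Qed.

(** The elements of [t] are adjoined one at a time; normality of the intermediate subgroups makes
    each step a cyclic extension. *)
Lemma noetherian_gen_ext N (t : seq G) :
    (forall K, N `<=` K -> K `<=` gen (N `|` [set` t]) ->
      gen (N `|` [set` t]) `<=` normalizer K) ->
  noetherian N -> noetherian (gen (N `|` [set` t])).
Proof.
elim: t => [|x t IH] normN noethN.
  by move=> H HN; apply: noethN => y /HN; apply: gen_sub => z [].
have genE : gen (N `|` [set` x :: t]) = gen (gen (N `|` [set` t]) `|` [set x]) :> set G.
  apply/seteqP; split; apply: gen_sub => y.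
    case=> [Ny|/=]; first by apply: mem_gen; left; apply: mem_gen; left.
    rewrite inE => /predU1P[->|yt]; first by apply: mem_gen; right.
    by apply: mem_gen; left; apply: mem_gen; right.
  case=> [|->]; last by apply: mem_gen; right; rewrite /= inE eqxx.
  by apply: genS => z [|/= zt]; [left|right; rewrite /= inE zt orbT].
have subt : gen (N `|` [set` t]) `<=` gen (N `|` [set` x :: t]).
  by apply: genS => z [|/= zt]; [left|right; rewrite /= inE zt orbT].
move=> H HN; apply: (@noetherian_cyclic_ext (gen (N `|` [set` t])) x).
- apply: IH noethN => K NK Kt; apply: (subset_trans subt).
  by apply: normN => //; apply: subset_trans Kt _.
- apply: normN => //; first by move=> y Ny; apply: mem_gen; left.
  by apply: mem_gen; right; rewrite /= inE eqxx.
- by rewrite -genE.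
Qed.

(** By bilinearity, commutators of generators of one factor of the series with generators of the
    group generate the next factor. *)
Lemma lcs_fin_gen (s : seq G) k : gen [set` s] = [set: G] :> set G ->
  exists t : seq G, [set` t] `<=` lcs (subgroupT G) k /\
    lcs (subgroupT G) k `<=` gen (lcs (subgroupT G) k.+1 `|` [set` t]).
Proof.
move=> gens; elim: k => [|k [t [tk kt]]].
  exists s; split=> // x _; have : gen [set` s] x by rewrite gens.
  by apply: genS => y; right.
exists [seq [~ u, x] | u <- t, x <- s]; split.
  by move=> _ /allpairsP[[u x] /= [ut xs ->]]; apply: lcsR => //; exact: tk.
set B := gen _.
have PB : lcs (subgroupT G) k.+2 `<=` B by move=> y ?; apply: mem_gen; left.
have BP : B `<=` lcs (subgroupT G) k.+1.
  apply: gen_sub => y [|/allpairsP[[u x] /= [ut xs ->]]]; first exact: lcsS.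
  by apply: lcsR => //; exact: tk.
have tB u x : u \in t -> B [~ u, x].
  move=> ut; have ku := tk _ ut.
  suff : gen [set` s] `<=` Subgroup (commgr_subgroup BP PB ku).
    by rewrite gens => /(_ x I) [].
  apply: gen_sub => y ys; split=> //; apply: mem_gen; right.
  by apply/allpairsP; exists (u, y).
apply: gen_sub => _ [u ku [x _ <-]].
have Px : subgroupT G x by [].
suff BF : gen (lcs (subgroupT G) k.+1 `|` [set` t]) `<=` Subgroup (commgl_subgroup BP PB Px).
  by have [] := BF _ (kt _ ku).
apply: gen_sub => v [kv|vt]; split.
- exact: lcsS.
- by apply: (PB _); exact: lcsR.
- exact: tk.
- exact: tB.
Qed.

Lemma fg_nilpotent_noetherian : finitely_generated G -> nilpotent_group G ->
  noetherian (subgroupT G).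
Proof.
move=> [A /finite_seqP[s ->] gens] [c Gc1].
suff lcs_noeth j k : (c <= j + k)%N -> noetherian (lcs (subgroupT G) k).
  by apply: (lcs_noeth c 0%N); rewrite addn0.
elim: j k => [|j IH] k.
  rewrite add0n => ck H Hk; exists [::]; apply/seteqP; split=> x.
    move=> /Hk /(lcs_leq ck); rewrite lcsT Gc1 => ->; exact: subgroup1.
  by apply: gen_sub.
rewrite addSnnS => /IH noeth1.
have [t [tk kt]] := lcs_fin_gen k gens.
move=> H Hk; apply: (noetherian_gen_ext (t := t) _ noeth1); last exact: subset_trans kt.
(* Commutators with elements of [K] fall in [lcs k.+1], hence back in [K]. *)
move=> K k1K Kt x xt h.
have Kk : K `<=` lcs (subgroupT G) k.
  by apply: subset_trans Kt _; apply: gen_sub => y [|/tk//]; exact: lcsS.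
by split=> Kh; rewrite conjg_comm; apply: subgroupM => //; apply: k1K;
  apply: lcsR => //; exact: Kk.
Qed.

(** Otherwise dependent choice gives a strictly increasing sequence; the finitely many generators of
    its union already lie in one term. *)
Lemma noetherian_max (Q : subgroup G -> Prop) : noetherian (subgroupT G) ->
  (exists H, Q H) -> exists2 H, Q H & forall K, Q K -> H `<=` K -> K `<=` H.
Proof.
move=> noeth [H0 QH0]; apply: contrapT => /forall2NP noMax.
have nextP (H : {H | Q H}) : exists K : {H | Q H}, sval H `<=` sval K /\ ~ sval K `<=` sval H.
  have [//|/existsNP [K /not_implyP[QK /not_implyP[HK nKH]]]] := noMax (sval H).
    by move: (svalP H).
  by exists (exist _ K QK).
have [next nextE] := choice nextP.
pose C n : subgroup G := sval (iter n next (exist _ H0 QH0)).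
have CS n : C n `<=` C n.+1 /\ ~ C n.+1 `<=` C n by exact: nextE.
have Cmono m n : (m <= n)%N -> C m `<=` C n.
  move=> /subnK <-; elim: (n - m)%N => // k IH; apply: subset_trans IH _.
  exact: (CS _).1.
have sU : is_subgroup (\bigcup_n C n).
  apply: is_subgroupI => [|x y [m _ Cx] [n _ Cy]|x [n _ Cx]].
  - by exists 0%N => //; exact: subgroup1.
  - exists (maxn m n) => //; apply: subgroupM.
      by apply: Cmono Cx; exact: leq_maxl.
    by apply: Cmono Cy; exact: leq_maxr.
  - by exists n => //; exact: subgroupV.
have [s Us] : exists s : seq G, Subgroup sU = gen [set` s] :> set G.
  by apply: noeth => x _.
have [n sn] : exists n, [set` s] `<=` C n.
  have : [set` s] `<=` Subgroup sU by rewrite Us => x; exact: mem_gen.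
  elim: {Us} s => [|x s IH] sU'; first by exists 0%N.
  have [|n sn] := IH; first by move=> y ys; apply: sU'; rewrite /= inE ys orbT.
  have [|m _ Cx] := sU' x; first by rewrite /= inE eqxx.
  exists (maxn m n) => y /=; rewrite inE => /predU1P[->|/sn].
    by apply: Cmono Cx; exact: leq_maxl.
  by apply: Cmono; exact: leq_maxr.
apply: (CS n).2 => x Cx.
by apply: (gen_sub sn); rewrite -Us; exists n.+1.
Qed.
(** The conjugates of [H] by the powers of [g] form an ascending chain, which becomes stationary;
    conjugating back gives equality at the first step. *)
Lemma noetherian_conj_normalizer H g : noetherian (subgroupT G) ->
  (forall h, H h -> H (h ^ g^-1)) -> normalizer H g.
Proof.
move=> noeth Hg.
have sC k : is_subgroup [set x | H (x ^ (g ^- k))].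
  apply: is_subgroupI => [|x y|x] /=; rewrite ?conj1g ?conjMg ?conjVg.
  - exact: subgroup1.
  - exact: subgroupM.
  - exact: subgroupV.
have [|_ [k ->] kmax] := noetherian_max noeth (Q := fun L => exists k, L = Subgroup (sC k)).
  by exists (Subgroup (sC 0%N)), 0%N.
have Ck1 : Subgroup (sC k.+1) `<=` Subgroup (sC k).
  apply: kmax; first by exists k.+1.
  by move=> x /= /Hg; rewrite -conjgM -invgM -expgS.
move=> h; split=> [Hh|]; last exact: Hg.
have /= := Ck1 (h ^ (g ^+ k.+1)).
by rewrite -!conjgM mulgV conjg1 expgS mulgK; apply.
Qed.

End Noetherian.

(** * Finite-dimensional subspaces *)

Local Open Scope ring_scope.

Section LinearAlgebra.
Variable K : fieldType.
Implicit Types (E V : lmodType K) (W : vectType K).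

Definition subspace E (U : set E) :=
  U 0 /\ forall k u v, U u -> U v -> U (k *: u + v).

Lemma submod_closedP E (U : set E) : submod_closed [in U] <-> subspace U.
Proof.
split=> [[U0 UD]|[U0 UD]].
  by split=> [|k u v Uu Uv]; [move: U0|move: (UD k u v)]; rewrite !inE; auto.
by split=> [|k u v]; rewrite !inE //; exact: UD.
Qed.

Section Subspace.
Variables (E : lmodType K) (U : set E).
Hypothesis sU : subspace U.

Lemma subspaceZ k u : U u -> U (k *: u).
Proof. by move=> Uu; rewrite -[_ *: u]addr0; apply: sU.2 => //; exact: sU.1. Qed.

Lemma subspaceD u v : U u -> U v -> U (u + v).
Proof. by move=> Uu Uv; rewrite -[u]scale1r; exact: sU.2. Qed.

Lemma subspaceB u v : U u -> U v -> U (u - v).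
Proof. by move=> Uu Uv; apply: subspaceD => //; rewrite -scaleN1r;
  exact: subspaceZ. Qed.

Lemma subspace_sum (I : Type) (r : seq I) (F : I -> E) :
  (forall i, U (F i)) -> U (\sum_(i <- r) F i).
Proof. by move=> UF; apply: big_ind => //; [exact: sU.1|exact: subspaceD]. Qed.

End Subspace.

Lemma linear_exists E V (f : E -> V) : linear f ->
  exists g : {linear E -> V}, g = f :> (E -> V).
Proof.
move=> lf; pose gM := GRing.isLinear.Build K E V _ f lf.
by exists (HB.pack_for {linear E -> V} f gM).
Qed.

(** A [vspace] of maximal dimension inside [U] misses no vector of [U]. *)
Lemma subspace_vspace W (U : set W) : subspace U ->
  exists X : {vspace W}, forall w, U w <-> w \in X.
Proof.
move=> sU;
  pose D d := `[< exists2 X : {vspace W}, \dim X = d & forall w, w \in X -> U w >].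
have exD : exists d, D d.
  exists 0%N; apply/asboolP; exists 0%VS; first exact: dimv0.
  by move=> w; rewrite memv0 => /eqP->; exact: sU.1.
have leD d : D d -> (d <= \dim {: W})%N.
  by move=> /asboolP[X <- _]; apply: dimvS; exact: subvf.
case: (ex_maxnP exD leD) => d /asboolP[X dX XU] maxd; exists X => w; split=> [Uw|/XU//].
apply: contrapT => /negP wX; have := maxd (\dim (X + <[w]>)).
have /[swap]/[apply] : D (\dim (X + <[w]>)); last first.
  apply/negP; rewrite -dX -ltnNge ltn_neqAle dimvS ?addvSl// andbT.
  apply: contra wX => dXw; have /eqP -> : X == (X + <[w]>)%VS.
    by rewrite eqEdim addvSl /= (eqP dXw).
  by rewrite -[X in X \in _]add0r memv_add ?mem0v ?memv_line.
apply/asboolP; exists (X + <[w]>)%VS => // _ /memv_addP[x /XU Ux [_ /vlineP[k ->] ->]].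
by rewrite addrC; apply: sU.2.
Qed.

Lemma subspace_preim E V (f : {linear E -> V}) (U : set V) :
  subspace U -> subspace (f @^-1` U).
Proof.
move=> sU; split=> [|k u v Uu Uv]; rewrite /preimage /=.
  by rewrite linear0; exact: sU.1.
by rewrite linearP; exact: sU.2.
Qed.

Lemma subspace_image E V (f : {linear E -> V}) (U : set E) :
  subspace U -> subspace (f @` U).
Proof.
move=> sU; split=> [|k _ _ [u Uu <-] [v Uv <-]].
  by exists 0; [exact: sU.1|exact: linear0].
by exists (k *: u + v); [exact: sU.2|exact: linearP].
Qed.

Lemma linear_basis W E (f : {linear W -> E}) w :
  f w = \sum_i coord (vbasis {: W}) i w *: f (vbasis {: W})`_i.
Proof.
rewrite {1}(coord_vbasis (memvf w)) linear_sum.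
by apply: eq_bigr => i _; rewrite linearZ.
Qed.

Lemma finite_dimensional_sub W E (f : {linear W -> E}) (S : set E) :
  subspace S -> S `<=` range f -> finite_dimensional S.
Proof.
move=> sS Sf; have [X SX] := subspace_vspace (subspace_preim f sS).
exists (\dim X), (fun i => f (vbasis X)`_i); apply/seteqP; split=> [v Sv|_ [c _ <-]].
  have [w _ fw] := Sf v Sv; exists (fun i => coord (vbasis X) i w) => //=.
  have /SX wX : (f @^-1` S) w by rewrite /preimage /= fw.
  rewrite -fw [in RHS](coord_vbasis wX) linear_sum; apply: eq_bigr => i _.
  by rewrite linearZ.
apply: subspace_sum => // i; apply: subspaceZ => //.
by apply/(SX _).2/vbasis_mem/mem_nth; rewrite size_tuple.
Qed.

Lemma linear_lift W W' E (f : {linear W -> E}) (L : {linear W' -> E}) :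
  range f `<=` range L -> exists a : 'Hom(W, W'), forall w, f w = L (a w).
Proof.
move=> fL; have /choice[c cP] : forall w, exists c, f w = L c.
  by move=> w; have [|c _ <-] := fL (f w); [exists w|exists c].
have [|a aE] := @linear_exists W W'
  (fun w => \sum_i coord (vbasis {: W}) i w *: c (vbasis {: W})`_i).
  move=> k u v /=; rewrite scaler_sumr -big_split; apply: eq_bigr => i _ /=.
  by rewrite linearP scalerDl scalerA.
exists (linfun a) => w; rewrite lfunE aE linear_basis linear_sum.
by apply: eq_bigr => i _; rewrite linearZ /= cP.
Qed.

End LinearAlgebra.

(** * Irreducible subrepresentations of finite-dimensional stable subspaces *)

Section Subrepresentations.
Variables (G : groupType) (K : fieldType) (V : lmodType K).
Variable pi : representation (subgroupT G) V.
Implicit Types (H : subgroup G) (W : vectType K).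

Definition stable H (Q : set V) := forall h, H h -> forall v, Q v -> Q (pi h v).

Lemma repr_exists H (W : lmodType K) (f : {linear W -> V}) : injective f ->
    (forall h, H h -> forall w, range f (pi h (f w))) ->
  exists sigma : representation H W,
    forall h, H h -> forall w, f (sigma h w) = pi h (f w).
Proof.
move=> f_inj fH.
have /choice[s sP] : forall g, exists s : {linear W -> W},
    H g -> forall w, f (s w) = pi g (f w).
  (* Off [H] the action is unconstrained; the identity is the default. *)
  move=> g; have [Hg|nHg] := pselect (H g); last by exists idfun.
  have /choice[s sP] w : exists w', f w' = pi g (f w).
    by have [w' _ fw'] := fH g Hg w; exists w'.
  have [|t tE] := @linear_exists _ W W s; last by exists t => _ w; rewrite tE.
  by move=> k u v; apply: f_inj; rewrite linearP /= !sP !linearP.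
have s1 w : s 1%g w = w.
  by apply: f_inj; rewrite sP ?repr_act1//; exact: subgroup1.
have sM g h : H g -> H h -> forall w, s (g * h)%g w = s g (s h w).
  by move=> Hg Hh w; apply: f_inj; rewrite !sP ?repr_actM//; exact: subgroupM.
by exists (Representation s1 sM).
Qed.

(** A nonzero stable subspace of least dimension is irreducible. Minimizing over subspaces [X] of
    the source also makes [L] injective on [X], since a complement in [X] of a line killed by [L]
    would have the same image. *)
Lemma irreducible_subrepr H W0 (L : {linear W0 -> V}) (Q : set V) :
    subspace Q -> Q `<=` range L -> stable H Q -> (exists2 v, Q v & v != 0) ->
  exists (W : vectType K) (sigma : representation H W) (f : {linear W -> V}),
    [/\ irreducible sigma, injective f, range f `<=` Q &
        forall h, H h -> forall w, f (sigma h w) = pi h (f w)].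
Proof.
move=> sQ QL QH [v0 Qv0 v0_neq0].
pose good (X : {vspace W0}) := [/\ forall x, x \in X -> Q (L x),
  exists2 x, x \in X & L x != 0 &
  forall h, H h -> forall x, x \in X -> exists2 y, y \in X & L y = pi h (L x)].
pose D d := `[< exists2 X, \dim X = d & good X >].
have exD : exists d, D d.
  have [X XQ] := subspace_vspace (subspace_preim L sQ).
  exists (\dim X); apply/asboolP; exists X => //; split.
  - by move=> x /XQ.
  - by have [x _ Lx] := QL _ Qv0; exists x; rewrite ?Lx//; apply/XQ;
      rewrite /preimage /= Lx.
  - move=> h Hh x /XQ Qx; have Qhx : Q (pi h (L x)) by exact: QH.
    by have [y _ Ly] := QL _ Qhx; exists y => //; apply/XQ; rewrite /preimage /= Ly.
case: (ex_minnP exD) => d /asboolP[X dX [XQ [x0 x0X Lx0] XH]] mind.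
have minX Y : good Y -> (\dim X <= \dim Y)%N.
  by move=> gY; rewrite dX; apply: mind; apply/asboolP; exists Y.
have L_inj x : x \in X -> L x = 0 -> x = 0.
  move=> xX Lx; apply/eqP/negPn/negP => x_neq0; pose Y := (X :\: <[x]>)%VS.
  have YX y : y \in X -> exists2 z, z \in Y & L z = L y.
    move=> yX; have : y \in (Y + <[x]>)%VS.
      by rewrite addv_diff; apply: subvP yX; exact: addvSl.
    case/memv_addP => z zY [_ /vlineP[k ->] ->]; exists z => //.
    by rewrite linearD linearZ /= Lx scaler0 addr0.
  have subYX y : y \in Y -> y \in X by apply/subvP; exact: diffvSl.
  have : (\dim X <= \dim Y)%N.
    apply: minX; split.
    - by move=> y /subYX; exact: XQ.
    - by have [z zY Lz] := YX _ x0X; exists z; rewrite ?Lz.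
    - move=> h Hh y /subYX yX; have [z zX <-] := XH h Hh y yX.
      by have [t tY Lt] := YX _ zX; exists t.
  have /capv_idPr capx : (<[x]> <= X)%VS by rewrite -memvE.
  by rewrite leqNgt -(dimv_cap_compl X <[x]>) capx dim_vline x_neq0 ltnS leqnn.
pose f : {linear subvs_of X -> V} := L \o vsval.
have f_inj : injective f.
  move=> u v fuv; apply/val_inj/eqP; rewrite -subr_eq0; apply/eqP.
  by apply: L_inj; [exact: rpredB (subvsP u) (subvsP v)|rewrite linearB /=;
    move/eqP: fuv; rewrite -subr_eq0 => /eqP].
have fH h : H h -> forall w, range f (pi h (f w)).
  move=> Hh w; have [y yX Ly] := XH h Hh _ (subvsP w).
  by exists (vsproj X y) => //=; rewrite vsprojK.
have [sigma fsigma] := repr_exists f_inj fH.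
exists (subvs_of X), sigma, f; split=> //; last by move=> _ [w _ <-]; apply: XQ;
  exact: subvsP.
split=> [|U /submod_closedP sU UH].
  by exists (vsproj X x0); apply: contraNneq Lx0 => px0;
    rewrite -(vsprojK x0X) px0 linear0.
have [U0|/existsNP[u /not_implyP[Uu /eqP u_neq0]]] := pselect (forall u, U u -> u = 0).
  by left; apply/seteqP; split=> [u /U0|_ ->]; [|exact: sU.1].
right; apply/seteqP; split=> // w _.
have [Y UY] := subspace_vspace (subspace_image vsval sU).
have YX : (Y <= X)%VS by apply/subvP => y /UY[z _ <-]; exact: subvsP.
have /eqP YeqX : Y == X.
  rewrite eqEdim YX /=; apply: minX; split.
  - by move=> y /(subvP YX); exact: XQ.
  - exists (vsval u); first by apply/UY; exists u.
    by apply: contra u_neq0 => /eqP Lu; rewrite -(inj_eq f_inj) linear0; apply/eqP.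
  - move=> h Hh _ /UY[z Uz <-]; exists (vsval (sigma h z)); last exact: fsigma.
    by apply/UY; exists (sigma h z) => //; exact: UH.
have /UY[z Uz /val_inj <-//] : vsval w \in Y by rewrite YeqX; exact: subvsP.
Qed.

End Subrepresentations.

(** * Stabilizers of sums of twists *)

Section Stabilizers.
Variables (G : groupType) (K : fieldType) (V : lmodType K).
Variable pi : representation (subgroupT G) V.
Implicit Types (H : subgroup G) (g h : G).

Lemma piM g h v : pi (g * h)%g v = pi g (pi h v).
Proof. exact: repr_actM. Qed.

Lemma piVK g v : pi g (pi g^-1%g v) = v.
Proof. by rewrite -piM mulgV repr_act1. Qed.

Fact stabilizer_subproof (Q : set V) :
  is_subgroup [set g | forall v, Q v -> Q (pi g v) /\ Q (pi g^-1%g v)].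
Proof.
apply: is_subgroupI => [v Qv|g h Qg Qh v Qv|g Qg v Qv].
- by rewrite invg1 !repr_act1.
- by rewrite invgM !piM; split; [apply: (Qg _ _).1;
    apply: (Qh _ _).1|apply: (Qh _ _).2; apply: (Qg _ _).2].
- by rewrite invgK; split; [exact: (Qg _ _).2|exact: (Qg _ _).1].
Qed.

Definition stabilizer (Q : set V) : subgroup G := Subgroup (stabilizer_subproof Q).

Definition admissible H := exists (W : vectType K) (rho : representation H W),
  [/\ irreducible rho,
      rep_hom rho (restriction pi H) <> [set 0] &
      finite_dimensional (rep_hom rho (restriction pi H))].

Lemma rep_hom_subspace H (W : lmodType K) (rho : representation H W) :
  subspace (rep_hom rho (restriction pi H)).
Proof.
split=> [|k f f' [lf fH] [lf' f'H]].
  split=> [k u v|h Hh v]; first by rewrite scaler0 addr0.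
  by rewrite linear0.
split=> [c u v|h Hh v]; rewrite !fctE.
  by rewrite lf lf' !scalerDr !scalerA [c * k]mulrC addrACA.
by rewrite fH// f'H//= linearP.
Qed.

Section Twists.
Variables (H : subgroup G) (W : vectType K) (rho : representation H W).
Hypothesis irr_rho : irreducible rho.
Variables (n : nat) (e : 'I_n -> {linear W -> V}).
Hypothesis eH : forall i h, H h -> forall u, e i (rho h u) = pi h (e i u).
Hypothesis e_span : forall f : {linear W -> V},
  (forall h, H h -> forall u, f (rho h u) = pi h (f u)) ->
  exists c, forall u, f u = \sum_i c i *: e i u.

Definition twist (p : G * 'I_n) (u : W) : V := pi p.1 (e p.2 u).

(** The sum of the ranges of the twists in [s], unfolded one summand at a time to suit
    [hom_from_twist_sum]. *)
Fixpoint twist_sum (s : seq (G * 'I_n)) : set V :=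
  if s is p :: s' then [set v | exists u, twist_sum s' (v - twist p u)]
  else [set 0].

Lemma twist_linear p : linear (twist p).
Proof. by move=> k u v; rewrite /twist !linearP. Qed.

HB.instance Definition _ p :=
  GRing.isLinear.Build K W V _ (twist p) (twist_linear p).

Lemma twist_sum_range s : exists (W0 : vectType K) (L : {linear W0 -> V}),
  twist_sum s = range L.
Proof.
elim: s => [|p s [W0 [L LE]]].
  have [|L LE] := @linear_exists K W V (fun=> 0).
    by move=> k u v; rewrite scaler0 addr0.
  exists W, L; rewrite LE; apply/seteqP; split=> [_ ->|_ [w _ <-]//].
  by exists 0.
have [|L' L'E] := @linear_exists K (W * W0)%type V (fun x => twist p x.1 + L x.2).
  by move=> k u v /=; rewrite !linearP scalerDr addrACA.
exists (W * W0)%type, L'; rewrite /= LE L'E; apply/seteqP;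
  split=> [v [u [w _ Lw]]|_ [[u w] _ <-]].
  by exists (u, w) => //=; rewrite Lw addrC subrK.
by exists u, w => //=; rewrite addrC addKr.
Qed.

Lemma twist_sum_subspace s : subspace (twist_sum s).
Proof.
have [W0 [L ->]] := twist_sum_range s.
by apply: subspace_image; split.
Qed.

Lemma mem_twist_sum s p u : p \in s -> twist_sum s (twist p u).
Proof.
elim: s => //= q s IH; rewrite inE => /predU1P[->|ps].
  by exists u; rewrite subrr; exact: (twist_sum_subspace _).1.
by exists 0; rewrite linear0 subr0; exact: IH.
Qed.

Lemma twist_sum_ind (U : set V) s : subspace U ->
  (forall p u, p \in s -> U (twist p u)) -> twist_sum s `<=` U.
Proof.
move=> sU; elim: s => [|p s IH] sT v /=; first by move=> ->; exact: sU.1.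
move=> [u su]; rewrite -[v](subrK (twist p u)); apply: subspaceD => //.
  by apply: IH su => q w qs; apply: sT; rewrite inE qs orbT.
by apply: sT; rewrite inE eqxx.
Qed.

Lemma twistJ g i h u : normalizer H g -> H h ->
  pi h (twist (g, i) u) = twist (g, i) (rho (h ^ g)%g u).
Proof.
move=> Ng Hh; rewrite /twist /= eH; last exact: (Ng h).1.
by rewrite -!piM /conjg !mulgA mulgV mul1g.
Qed.

Lemma twist_sum_stable s : (forall p, p \in s -> normalizer H p.1) ->
  stable pi H (twist_sum s).
Proof.
move=> Ns h Hh; have sU := subspace_preim (pi h) (twist_sum_subspace s).
apply: (twist_sum_ind sU) => -[g i] u ps; rewrite /preimage /= twistJ //.
  exact: mem_twist_sum.
exact: (Ns _ ps).
Qed.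

(* An irreducible submodule of a sum of irreducible modules is isomorphic to  *)
(* one of them, so that homomorphisms out of it come from the twists of rho.  *)
Lemma hom_from_twist_sum s (W2 : lmodType K) (sigma : representation H W2)
    (f phi : {linear W2 -> V}) :
    (forall p, p \in s -> normalizer H p.1) ->
    irreducible sigma -> injective f -> range f `<=` twist_sum s ->
    (forall h, H h -> forall w, f (sigma h w) = pi h (f w)) ->
    (forall h, H h -> forall w, phi (sigma h w) = pi h (phi w)) ->
  exists2 p, p \in s & exists2 f' : {linear W -> V},
    (forall h, H h -> forall u, f' (rho h u) = pi h (f' u)) &
    range phi `<=` range (pi p.1 \o f').
Proof.
move=> + irr_sigma f_inj + fH phiH; have [[w0 w0_neq0] sigmaU] := irr_sigma.
elim: s => [|p s IH] Ns fs.
  by case/eqP: w0_neq0; apply: f_inj; rewrite linear0; apply: fs; exists w0.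
have Nss q : q \in s -> normalizer H q.1 by move=> qs; apply: Ns; rewrite inE qs orbT.
have Np : normalizer H p.1 by apply: Ns; rewrite inE eqxx.
have sS := twist_sum_subspace s; have SH := twist_sum_stable Nss.
pose A := f @^-1` twist_sum s.
have sA : subspace A by exact: subspace_preim.
have [h Hh w|A0|AT] := sigmaU A ((submod_closedP _).2 sA).
- by rewrite /A /preimage /= fH//; exact: SH.
(* Here [f] is injective modulo [twist_sum s], so the relation [twist_sum s (f w - twist p u)]
   determines [w] from [u]. Its domain [D] is a nonzero submodule of [rho], hence everything, and
   the resulting map [tau] intertwines [rho] with a conjugate of [sigma]. *)
- have f_u w : exists u, twist_sum s (f w - twist p u) by apply: fs; exists w.
  have f_inj_mod w w' v : twist_sum s (f w - v) -> twist_sum s (f w' - v) -> w = w'.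
    move=> sw sw'; apply/eqP; rewrite -subr_eq0; apply/eqP.
    suff : A (w - w') by rewrite A0.
    rewrite /A /preimage /= linearB; have := subspaceB sS sw sw'.
    by rewrite opprB addrA subrK.
  pose D := [set u | exists w, twist_sum s (f w - twist p u)].
  have DJ h u w : H h -> twist_sum s (f w - twist p u) ->
      twist_sum s (f (sigma (h ^ p.1^-1)%g w) - twist p (rho h u)).
    move=> Hh su; have Hh' := (Np h).2 Hh.
    rewrite fH// -[in X in rho X _](conjgKV p.1 h).
    by case: p Np su Hh' {f_u D Ns fs} => g i /= Np su Hh';
      rewrite -twistJ// -linearB; exact: SH.
  have sD : subspace D.
    split=> [|k u v [w su] [w' sv]].
      by exists 0; rewrite linear0 linear0 subr0; exact: sS.1.
    exists (k *: w + w'); rewrite linearP linearP /= opprD addrACA -scalerN -scalerDr.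
    exact: sS.2.
  have [_ rhoU] := irr_rho.
  have [h Hh u [w su]|D0|DT] := rhoU D ((submod_closedP _).2 sD).
  - by exists (sigma (h ^ p.1^-1)%g w); exact: DJ.
  - case/eqP: w0_neq0; suff : A w0 by rewrite A0.
    have [u su] := f_u w0; have : D u by exists w0.
    by rewrite D0 => u0; move: su; rewrite u0 linear0 subr0.
  - have /choice[t tP] : forall u, exists w, twist_sum s (f w - twist p u).
      by move=> u; suff : D u by []; rewrite DT.
    have [|tau tauE] := @linear_exists K W W2 t.
      move=> k u v; apply: (f_inj_mod _ _ _ (tP _)).
      rewrite linearP linearP /= opprD addrACA -scalerN -scalerDr.
      by apply: sS.2; exact: tP.
    exists p; first by rewrite inE eqxx.
    exists (pi p.1^-1%g \o (phi \o tau)) => [h Hh u /=|_ [w _ <-]]; last first.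
      have [u su] := f_u w; exists u => //=; rewrite piVK tauE.
      by rewrite (f_inj_mod _ _ _ (tP u) su).
    have -> : tau (rho h u) = sigma (h ^ p.1^-1)%g (tau u).
      by rewrite tauE; apply: (f_inj_mod _ _ _ (tP _)); exact: DJ.
    rewrite phiH; last exact: (Np h).2.
    by rewrite -!piM /conjg invgK mulKg.
- have [|p' p's Hp'] := IH Nss; first by move=> _ [w _ <-]; suff : A w by [];
    rewrite AT.
  by exists p' => //; rewrite inE p's orbT.
Qed.

(** For [gs] reduced to the identity, this is the sum of the images of all homomorphisms from [rho]
    to [pi], by [e_span]. *)
Definition twist_closure (gs : seq G) := twist_sum [seq (g, i) | g <- gs, i <- enum 'I_n].

Lemma mem_twist_closure gs g (f : {linear W -> V}) u : g \in gs ->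
    (forall h, H h -> forall u, f (rho h u) = pi h (f u)) ->
  twist_closure gs (pi g (f u)).
Proof.
move=> ggs fH; have [c ->] := e_span fH; rewrite linear_sum.
have sQ := twist_sum_subspace [seq (g, i) | g <- gs, i <- enum 'I_n].
apply: subspace_sum => // i; rewrite linearZ; apply: subspaceZ => //.
apply: (@mem_twist_sum _ (g, i)); apply/allpairsP; exists (g, i).
by rewrite mem_enum.
Qed.

Lemma twist_closure_ind (U : set V) gs : subspace U ->
  (forall g i u, g \in gs -> U (pi g (e i u))) -> twist_closure gs `<=` U.
Proof.
move=> sU gsU; apply: twist_sum_ind => // p u /allpairsP[[g i] [ggs _ ->]].
exact: gsU.
Qed.

(* An irreducible subrepresentation sigma of the twist closure under its      *)
(* stabilizer is generated by any irreducible H-submodule X, and homs from X  *)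
(* to V land in the twist closure, hence so do all homs from sigma to V.      *)
Lemma admissible_stabilizer gs : (exists i u, e i u != 0) -> gs != [::] ->
    (forall g, g \in gs -> normalizer H g) ->
  admissible (stabilizer (twist_closure gs)) /\
    H `<=` stabilizer (twist_closure gs).
Proof.
move=> [i0 [u0 e_neq0]] gs_neq0 Ngs; set Q := twist_closure gs.
have sQ : subspace Q by exact: twist_sum_subspace.
have Ns p : p \in [seq (g, i) | g <- gs, i <- enum 'I_n] -> normalizer H p.1.
  by move=> /allpairsP[[g i] [/Ngs Ng _ ->]].
have QH : stable pi H Q by exact: twist_sum_stable.
have HQ : H `<=` stabilizer Q.
  by move=> h Hh v Qv; split; apply: QH => //; exact: subgroupV.
split=> //.
have [W0 [L QL]] := twist_sum_range [seq (g, i) | g <- gs, i <- enum 'I_n].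
have {}QL : Q = range L by [].
have QL' : Q `<=` range L by rewrite -QL.
have QS : stable pi (stabilizer Q) Q by move=> g Qg v /Qg [].
have Qn0 : exists2 v, Q v & v != 0.
  case: gs gs_neq0 @Q Ngs {sQ Ns QH HQ QL QL' QS} => // g gs _ Q _.
  exists (pi g (e i0 u0)); last first.
    by apply: contra e_neq0 => /eqP pe;
      rewrite -[e i0 u0](repr_act1 pi) -(mulVg g) piM pe linear0.
  by apply: mem_twist_closure; [rewrite inE eqxx|exact: eH].
have [W1 [sigma1 [f1 [irr1 f1_inj f1Q f1H]]]] := irreducible_subrepr sQ QL' QS Qn0.
have [[w1 w1_neq0] sigma1U] := irr1.
have sf1 : subspace (range f1) by apply: subspace_image.
have f1HS : stable pi H (range f1).
  by move=> h Hh _ [w _ <-]; exists (sigma1 h w) => //; apply: f1H; exact: HQ.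
have f1n0 : exists2 v, range f1 v & v != 0.
  by exists (f1 w1); [exists w1|rewrite -(linear0 f1) (inj_eq f1_inj)].
have [W2 [sigma2 [f2 [irr2 f2_inj f2f1 f2H]]]] :=
  irreducible_subrepr sf1 (@subset_refl _ _) f1HS f1n0.
have [[w2 w2_neq0] _] := irr2.
have [a aE] := linear_lift f2f1.
have homQ (phi : {linear W1 -> V}) :
    (forall h, stabilizer Q h -> forall v, phi (sigma1 h v) = pi h (phi v)) ->
  range phi `<=` Q.
  move=> phiH; pose A := phi @^-1` Q.
  have sA : subspace A by exact: subspace_preim.
  have [h Hh w|A0|AT] := sigma1U A ((submod_closedP _).2 sA).
  - by rewrite /A /preimage /= phiH//; exact: QS.
  (* Restricted to the [H]-submodule [W2] through [a], [phi] has range in a translate of the image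
     of a homomorphism from [rho], hence in [Q]; so [A] cannot be zero. *)
  - have phi2H h : H h -> forall w, (phi \o a) (sigma2 h w) = pi h ((phi \o a) w).
      move=> Hh w /=; rewrite -phiH; last exact: HQ.
      by congr (phi _); apply: f1_inj; rewrite -aE f2H// aE f1H//; exact: HQ.
    have f2Q : range f2 `<=` Q by exact: subset_trans f1Q.
    have [[g i] /allpairsP[[g' i'] [/= ggs _ [gg' _]]] [f' f'H phif']] :=
      hom_from_twist_sum Ns irr2 f2_inj f2Q f2H phi2H.
    have : A (a w2).
      have [|u _ phiu] := phif' ((phi \o a) w2); first by exists w2.
      rewrite /A /preimage /= -[phi (a w2)]phiu /= gg'.
      exact: mem_twist_closure.
    rewrite A0 => aw2; case/eqP: w2_neq0; apply: f2_inj.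
    by rewrite aE aw2 !linear0.
  - by move=> _ [w _ <-]; suff : A w by []; rewrite AT.
exists W1, sigma1; split=> //.
  apply/seteqP => -[hom0 _]; have : [set 0] (f1 : W1 -> V).
    by apply: hom0; split; [exact: linearP|exact: f1H].
  move=> f10; case/eqP: w1_neq0; apply: f1_inj; rewrite linear0.
  by move: f10 => /= ->.
(* Homomorphisms from [sigma1] to [pi] land in the range of [L], hence are compositions of [L] with
   elements of the finite-dimensional ['Hom(W1, W0)]. *)
have [|M ME] := @linear_exists K 'Hom(W1, W0) (W1 -> V) (fun a w => L (a w)).
  by move=> k b b'; apply/funext => w; rewrite !fctE add_lfunE scale_lfunE linearP.
apply: (finite_dimensional_sub (f := M)); first exact: rep_hom_subspace.
move=> phi' [phi_lin phiH]; have [phi phiE] := linear_exists phi_lin.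
rewrite -phiE in phiH *; have phiL : range phi `<=` range L by rewrite -QL; exact: homQ.
by have [b bE] := linear_lift phiL; exists b => //; rewrite ME; apply/funext => w;
  rewrite bE.
Qed.

End Twists.

(** By maximality it suffices that the given element preserve some twist closure. If [y ^+ m] is in
    [H], use the translates by [y ^+ i] for i < m, which [y] permutes cyclically. If [theta]
    intertwines [rho] with its conjugate by [g], use the untranslated sum: composition with [theta]
    or its inverse turns translates of homomorphisms into homomorphisms. *)
Lemma admissible_max_normalizer H : admissible H ->
    (forall K, admissible K -> H `<=` K -> K `<=` H) ->
  exists (W : vectType K) (rho : representation H W) (f : {linear W -> V}),
    [/\ irreducible rho, exists u, f u != 0,
        forall h, H h -> forall u, f (rho h u) = pi h (f u),
        forall y, normalizer H y -> isolator H y -> H y &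
        forall g (theta : {linear W -> W}), normalizer H g ->
          (exists w, theta w != 0) ->
          (forall h, H h -> forall w, theta (rho h w) = rho (h ^ g^-1)%g (theta w)) ->
          H g].
Proof.
move=> [W [rho [irr_rho hom_neq0 [n [e0 homE]]]]] maxH.
have e0P i : rep_hom rho (restriction pi H) (e0 i).
  rewrite homE; exists (fun j => (i == j)%:R) => //=.
  rewrite (bigD1 i)//= eqxx scale1r big1 ?addr0// => j ji.
  by rewrite eq_sym (negbTE ji) scale0r.
have /choice[e eE] : forall i, exists f : {linear W -> V}, f = e0 i :> (W -> V).
  by move=> i; apply: linear_exists; exact: (e0P i).1.
have eH i h : H h -> forall u, e i (rho h u) = pi h (e i u).
  by move=> Hh u; rewrite !eE; exact: (e0P i).2.
have e_span (f : {linear W -> V}) :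
    (forall h, H h -> forall u, f (rho h u) = pi h (f u)) ->
  exists c, forall u, f u = \sum_i c i *: e i u.
  move=> fH; have : rep_hom rho (restriction pi H) f by split; first exact: linearP.
  rewrite homE => -[c _ fE]; exists c => u; rewrite -fE.
  rewrite fct_sumE; apply: eq_bigr => i _.
  by rewrite eE.
have [i0 [u0 e_neq0]] : exists i u, e i u != 0.
  apply: contrapT => noe; apply: hom_neq0; apply/seteqP; split=> [f|_ ->];
    last exact: (rep_hom_subspace rho).1.
  rewrite homE => -[c _ <-]; apply/funext => u /=; rewrite fct_sumE big1// => i _.
  rewrite fctE -eE; suff -> : e i u = 0 by rewrite scaler0.
  by apply/eqP/negPn/negP => eiu; apply: noe; exists i, u.
have stabH gs : gs != [::] -> (forall g, g \in gs -> normalizer H g) ->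
    stabilizer (twist_closure e gs) `<=` H.
  move=> gs0 Ngs; have [|adm HQ] := admissible_stabilizer irr_rho eH e_span _ gs0 Ngs.
    by exists i0, u0.
  exact: maxH.
have mem_closure := mem_twist_closure e_span.
exists W, rho, (e i0); split=> //; first by exists u0.
- exact: eH.
- move=> y Ny [m m0 Hym]; apply: (stabH [seq (y ^+ i)%g | i <- iota 0 m]).
  + by case: m m0 {Hym}.
  + by move=> _ /mapP[i _ ->]; exact: subgroupX.
  set Q := twist_closure e _.
  have sQ : subspace Q by exact: twist_sum_subspace.
  have memQ (i : nat) j u : (i < m)%N -> Q (pi (y ^+ i)%g (e j u)).
    by move=> im; apply: mem_closure; [apply: map_f; rewrite mem_iota|exact: eH].
  move=> v Qv; split; move: v Qv; apply: twist_closure_ind; try exact: subspace_preim.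
    move=> _ i u /mapP[j + ->]; rewrite mem_iota add0n /= => jm.
    rewrite -piM -expgS; have [jm'|] := ltnP j.+1 m; first exact: memQ.
    rewrite leq_eqVlt ltnNge jm orbF => /eqP <-.
    (* The exponent wraps around: [y ^+ m] is in [H], so it acts through [rho] and leaves exponent
       0. *)
    rewrite -eH// -[e i _](repr_act1 pi) -[1%g](expg0 y).
    exact: memQ.
  move=> _ i u /mapP[j + ->]; rewrite mem_iota add0n /=.
  case: j => [_|j jm]; last first.
    by rewrite -piM expgS mulKg; apply: memQ; exact: ltnW.
  rewrite expg0 repr_act1.
  have -> : (y^-1 = y ^+ m.-1 * (y ^+ m)^-1)%g.
    by rewrite -[X in (_ * (_ ^+ X)^-1)%g](prednK m0) expgS !gnorm.
  rewrite piM -eH; last exact: subgroupV.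
  by apply: memQ; rewrite prednK.
- move=> g theta Ng [w0 theta0] thetaH; apply: (stabH [:: 1%g]) => //.
    by move=> _ /[!inE] /eqP ->; exact: subgroup1.
  (* Schur's lemma: the kernel and the range of [theta] are submodules of [rho]. *)
  have [theta' thetaK thetaK'] : exists2 theta' : {linear W -> W},
      cancel theta theta' & cancel theta' theta.
    have [_ rhoU] := irr_rho.
    have thetaT w : exists w', theta w' = w.
      have sT : subspace (range theta) by apply: subspace_image; split.
      have [h Hh _ [u _ <-]|T0|TT] := rhoU _ ((submod_closedP _).2 sT).
      - exists (rho (h ^ g)%g u) => //; rewrite thetaH; last exact: (Ng h).1.
        by rewrite -conjgM mulgV conjg1.
      - by case/eqP: theta0; suff : [set 0] (theta w0) by []; rewrite -T0; exists w0.
      - by have [w' _ <-] : range theta w by [rewrite TT]; exists w'.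
    have /choice[t tP] := thetaT.
    have sN : subspace (theta @^-1` [set 0]).
      by apply: subspace_preim; split=> // k u v -> ->; rewrite /mkset scaler0 addr0.
    have theta_inj : injective theta.
      have [h Hh u /= thu0|N0|NT] := rhoU _ ((submod_closedP _).2 sN).
      - by rewrite /preimage /= thetaH// thu0 linear0.
      - move=> u v uv; apply/eqP; rewrite -subr_eq0; apply/eqP.
        suff : (theta @^-1` [set 0]) (u - v) by rewrite N0.
        by rewrite /preimage /= linearB /= uv subrr.
      - by case/eqP: theta0; suff : (theta @^-1` [set 0]) w0 by []; rewrite NT.
    have [|theta' theta'E] := @linear_exists K W W t.
      by move=> k u v; apply: theta_inj; rewrite linearP !tP.
    exists theta'; rewrite theta'E => u //.
    by apply: theta_inj; rewrite tP.
  set Q := twist_closure e _.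
  have memQ (f : {linear W -> V}) u :
      (forall h, H h -> forall u, f (rho h u) = pi h (f u)) -> Q (f u).
    by move=> fH; rewrite -[f u](repr_act1 pi); apply: mem_closure; rewrite ?inE.
  move=> v Qv; split; move: v Qv; apply: twist_closure_ind;
    try by apply/subspace_preim/twist_sum_subspace.
    move=> _ i u /[!inE] /eqP->; rewrite repr_act1.
    rewrite -[u]thetaK; apply: (memQ (pi g \o (e i \o theta'))) => h Hh {}u /=.
    have -> : theta' (rho h u) = rho (h ^ g)%g (theta' u).
      apply: (can_inj thetaK); rewrite thetaK' thetaH; last exact: (Ng h).1.
      by rewrite thetaK' -conjgM mulgV conjg1.
    rewrite eH; last exact: (Ng h).1.
    by rewrite -!piM /conjg !mulgA mulgV mul1g.
  move=> _ i u /[!inE] /eqP->; rewrite repr_act1 -[u]thetaK'.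
  apply: (memQ (pi g^-1%g \o (e i \o theta))) => h Hh {}u /=.
  rewrite thetaH// eH; last exact: (Ng h).2.
  by rewrite -!piM /conjg invgK !mulgA mulVg mul1g.
Qed.
End Stabilizers.

(** * Irreducibility of induced representations and Frobenius reciprocity *)

Section InducedSpace.
Variables (G : groupType) (K : fieldType) (H : subgroup G) (W : lmodType K).
Variable rho : representation H W.
Local Notation M := (ind_space rho).
Local Notation act := (ind_act (rho := rho)).
Implicit Types (L : subgroup G) (f m : M) (g h x y a : G) (w : W).

Lemma indH f h x : H h -> f (h * x)%g = rho h (f x).
Proof. by move=> Hh; have := ind_funP f; rewrite inE => -[fH _]; exact: fH. Qed.

Lemma ind_supp f : exists s : seq G, forall x, f x != 0 -> exists2 a, a \in s & H (x * a^-1)%g.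
Proof.
have := ind_funP f; rewrite inE => -[_ [A /finite_seqP[s ->] suppE]]; exists s => x fx.
have : [set x | f x != 0] x by [].
by rewrite suppE => -[a /= sa [h Hh <-]]; exists a => //; rewrite mulgK.
Qed.

Lemma ind_exists (F : G -> W) (s : seq G) :
    (forall h, H h -> forall x, F (h * x)%g = rho h (F x)) ->
    (forall x, F x != 0 -> exists2 a, a \in s & H (x * a^-1)%g) ->
  exists f : M, f = F :> (G -> W).
Proof.
move=> FH Fs; suff FP : F \in ind_pred rho by exists (IndSpace FP).
rewrite inE; apply: (ind_setP FH (finite_seq s)) => x /Fs[a sa Hxa].
by exists a => //; exists (x * a^-1)%g => //; rewrite mulgVK.
Qed.

Lemma ind_eq f f' : (forall x, f x = f' x) -> f = f'.
Proof. by move=> eqf; apply/val_inj/funext. Qed.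

Lemma ind_neq0 f : f != 0 -> exists x, f x != 0.
Proof.
move=> f_neq0; apply: contrapT => nof; case/eqP: f_neq0; apply: ind_eq => x.
by apply/eqP/negPn/negP => fx; apply: nof; exists x.
Qed.

Lemma act_comp g h f : act (g * h)%g f = act g (act h f).
Proof. by apply: ind_eq => x /=; rewrite mulgA. Qed.

Lemma mem_subgroupMl h x : H h -> H (h * x)%g <-> H x.
Proof.
move=> Hh; split=> [Hhx|Hx]; last exact: subgroupM.
by rewrite -(mulKg h x); apply: subgroupM => //; exact: subgroupV.
Qed.

Lemma delta_exists : exists delta : {linear W -> M},
  (forall w x, H x -> delta w x = rho x w) /\ (forall w x, ~ H x -> delta w x = 0).
Proof.
have /choice[d dE] : forall w, exists d : M,
    (forall x, H x -> d x = rho x w) /\ (forall x, ~ H x -> d x = 0).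
  move=> w;
    have [||d dE] := @ind_exists (fun x => if `[< H x >] then rho x w else 0) [:: 1%g].
  - move=> h Hh x;
      have -> : `[< H (h * x)%g >] = `[< H x >] by apply/asbool_equiv_eq/mem_subgroupMl.
    by case: asboolP => Hx; [rewrite repr_actM|rewrite linear0].
  - move=> x; case: asboolP => [Hx _|_]; last by rewrite eqxx.
    by exists 1%g; rewrite ?inE// invg1 mulg1.
  - by exists d; rewrite dE; split=> x Hx; case: asboolP.
have [|delta deltaE] := @linear_exists K W M d.
  move=> k u v; apply: ind_eq => x /=.
  change (d (k *: u + v) x = k *: d u x + d v x).
  have [Hx|nHx] := pselect (H x).
    by rewrite !(dE _).1// linearP.
  by rewrite !(dE _).2// scaler0 addr0.
by exists delta; rewrite deltaE; split=> w; have [] := dE w.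
Qed.

(** The canonical embedding of [rho] into the induced representation. *)
Definition delta : {linear W -> M} := projT1 (cid delta_exists).

Lemma deltaH w x : H x -> delta w x = rho x w.
Proof. exact: (projT2 (cid delta_exists)).1. Qed.

Lemma delta_notin w x : ~ H x -> delta w x = 0.
Proof. exact: (projT2 (cid delta_exists)).2. Qed.

Lemma delta_act h w : H h -> delta (rho h w) = act h (delta w).
Proof.
move=> Hh; apply: ind_eq => x /=; have [Hx|nHx] := pselect (H x).
  by rewrite !deltaH// ?repr_actM//; exact: subgroupM.
rewrite !delta_notin// => Hxh; apply: nHx; rewrite -(mulgK h x).
by apply: subgroupM => //; exact: subgroupV.
Qed.

Lemma restriction_exists L f : H `<=` L ->
  exists m : M, forall x, m x = if `[< L x >] then f x else 0.
Proof.
move=> HL; have [s sP] := ind_supp f.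
have [||m mE] := @ind_exists (fun x => if `[< L x >] then f x else 0) s.
- move=> h Hh x; have -> : `[< L (h * x)%g >] = `[< L x >].
    apply: asbool_equiv_eq; split=> Lx.
      by rewrite -(mulKg h x); apply: subgroupM => //; apply: subgroupV; exact: HL.
    by apply: subgroupM => //; exact: HL.
  by case: asboolP; rewrite ?indH// linear0.
- by move=> x; case: asboolP => [_ /sP//|_]; rewrite eqxx.
- by exists m => x; rewrite mE.
Qed.

End InducedSpace.

(** * Irreducibility of the induced representation *)

Section InducedIrreducible.
Variables (G : groupType) (K : fieldType) (H : subgroup G) (W : vectType K).
Variable rho : representation H W.
Local Notation M := (ind_space rho).
Local Notation act := (ind_act (rho := rho)).
Implicit Types (L : subgroup G) (f m : M) (g h x y a : G) (w : W).
Local Notation delta := (@delta G K H W rho).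

Hypothesis irr_rho : irreducible rho.
Hypothesis H_isolated : isolator H `<=` H.
Hypothesis H_conj : forall g, (forall h, H h -> H (h ^ g^-1)%g) -> normalizer H g.
Hypothesis H_inertia : forall g (theta : {linear W -> W}), normalizer H g ->
  (exists w, theta w != 0) ->
  (forall h, H h -> forall w, theta (rho h w) = rho (h ^ g^-1)%g (theta w)) -> H g.

Lemma eval_linear x (phi : {linear W -> M}) : linear (fun w => phi w x).
Proof. by move=> k u v; rewrite linearP. Qed.

(* By finite dimensionality, the images of phi have a common finite support   *)
(* modulo H; it is stable under right translations by H, so that each g in it *)
(* satisfies gHg^-1 <= H by isolation.                                        *)
Lemma mackey_support (phi : {linear W -> M}) :
    (forall h, H h -> forall w, phi (rho h w) = act h (phi w)) ->
  forall w x, phi w x != 0 -> H x.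
Proof.
move=> phiH w0 g phi_g.
have /choice[S SP] := fun w => ind_supp (phi w).
pose s := flatten [seq S (vbasis {: W})`_(nat_of_ord i) | i <- enum 'I_(\dim {: W})].
have sP w x : phi w x != 0 -> exists2 a, a \in s & H (x * a^-1)%g.
  have [theta thetaE] := linear_exists (eval_linear x phi).
  have := linear_basis theta w; rewrite thetaE => -> phi_x.
  have [i phi_i] : exists i : 'I_(\dim {: W}), phi (vbasis {: W})`_i x != 0.
    apply: contrapT => noi; case/eqP: phi_x; apply: big1 => i _.
    suff -> : phi (vbasis {: W})`_i x = 0 by rewrite scaler0.
    by apply/eqP/negPn/negP => phi_i; apply: noi; exists i.
  have [a Sa Hxa] := SP _ _ phi_i; exists a => //.
  by apply/flatten_mapP; exists i; rewrite ?mem_enum.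
have Hg h : H h -> H (h ^ g^-1)%g.
  (* By equivariance [phi (rho (h ^- k) w0)] takes at [g * h ^+ k] the nonzero value [phi w0 g]. So
     these points lie in finitely many cosets, two of them in the same one, and a positive power of
     the conjugate of [h] is in [H]. *)
  move=> Hh;
    have /choice[c cP] : forall k : nat, exists a, a \in s /\ H (g * h ^+ k * a^-1)%g.
    move=> k; have [|a sa Ha] := sP (rho (h ^- k)%g w0) (g * h ^+ k)%g;
      last by exists a.
    have Hhk : H (h ^- k)%g by apply: subgroupV; exact: subgroupX.
    by rewrite phiH//= mulgK.
  have /uniqPn : ~~ uniq (map c (iota 0 (size s).+1)).
    apply/negP => /uniq_leq_size /(_ (_ : {subset _ <= s})).
    rewrite size_map size_iota ltnn => /(_ _)/notF; apply.
    by move=> _ /mapP[k _ ->]; exact: (cP k).1.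
  move=> /(_ 1%g)[k [l [kl]]]; rewrite size_map size_iota => ls.
  rewrite !(nth_map 0%N) ?size_iota//; last exact: ltn_trans ls.
  rewrite !nth_iota//; last exact: ltn_trans ls.
  rewrite !add0n => ckl; apply: H_isolated; exists (l - k)%N; first by rewrite subn_gt0.
  rewrite -conjXg /conjg invgK.
  have := subgroupM (cP l).2 (subgroupV (cP k).2).
  by rewrite ckl !gnorm -{1}(subnK (ltnW kl)) expgnDr !gnorm.
have [theta thetaE] := linear_exists (eval_linear g phi).
apply: (@H_inertia g theta); first exact: H_conj.
  by exists w0; rewrite thetaE.
move=> h Hh w; rewrite thetaE phiH//= -indH; last exact: Hg.
by rewrite /conjg invgK !mulgA mulgVK.
Qed.

(** For [L] containing [H], this encodes irreducibility of the representation induced from [H] to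
    [L], viewed as the functions supported in [L]; the [delta w] generate it under [L]. *)
Definition absorbing L := forall U : set M, subspace U ->
  (forall l, L l -> forall f, U f -> U (act l f)) ->
  (exists2 f, U f & f != 0 /\ forall x, f x != 0 -> L x) ->
  forall w, U (delta w).

(** Through [delta], the functions supported on [H] are a copy of [rho]. *)
Lemma absorbing_base : absorbing H.
Proof.
move=> U sU UH [f Uf [f_neq0 fH]].
have fE : f = delta (f 1%g).
  apply: ind_eq => x; have [Hx|nHx] := pselect (H x).
    by rewrite deltaH// -indH// mulg1.
  by rewrite delta_notin//; apply/eqP/negPn/negP => /fH.
have [_ rhoU] := irr_rho; pose D := delta @^-1` U.
have sD : subspace D by exact: subspace_preim.
have [h Hh w Dw|D0|DT] := rhoU D ((submod_closedP _).2 sD).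
- by rewrite /D /preimage /= delta_act//; exact: UH.
- case/eqP: f_neq0; have : D (f 1%g) by rewrite /D /preimage /= -fE.
  by rewrite D0 => f1; rewrite fE f1 linear0.
- by move=> w; suff : D w by []; rewrite DT.
Qed.

(* Among the nonzero elements of U take one supported on the fewest L-cosets  *)
(* La, ...; elements of U with this support are determined by their values on *)
(* La, which fill up the functions on La. Lifting the functions delta w back  *)
(* to U gives a homomorphism from rho, whose support is in H by Mackey's      *)
(* argument.                                                                  *)
Lemma absorbing_normalizer L : H `<=` L -> absorbing L -> absorbing (normalizer L).
Proof.
move=> HL absL U sU UN [f0 Uf0 [f0_neq0 f0N]] w.
pose supp_in (s : seq G) f := forall x, f x != 0 -> exists2 a, a \in s & L (x * a^-1)%g.
suff reduce (s : seq G) f : (forall a, a \in s -> normalizer L a) -> U f -> f != 0 ->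
    supp_in s f -> U (delta w).
  have [s sP] := ind_supp f0.
  apply: (reduce [seq a <- s | `[< normalizer L a >]] f0) => //.
    by move=> a; rewrite mem_filter => /andP[/asboolP].
  move=> x f0x; have [a sa Hxa] := sP x f0x; exists a; last exact: HL.
  rewrite mem_filter sa andbT; apply/asboolP; rewrite -[a]invgK; apply: subgroupV.
  rewrite -(mulKg x a^-1%g); apply: subgroupM; first by apply: subgroupV; exact: f0N.
  by apply: subgroup_normalizer; exact: HL.
elim: s f => [|a s IH] f Ns Uf f_neq0 fs.
  by have [x /fs[]] := ind_neq0 f_neq0.
have Na : normalizer L a by apply: Ns; rewrite inE eqxx.
pose U' := [set f | U f /\ supp_in (a :: s) f].
(* A nonzero element of [U'] vanishing on the coset [L a] has smaller support, and induction
   applies; otherwise restriction to that coset is injective on [U']. *)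
have [[f' [Uf' f's] [f'_neq0 f'a]]|noU'] :=
    pselect (exists2 f, U' f & f != 0 /\ forall x, L x -> f (x * a)%g = 0).
  apply: (IH f') => // [b bs|x f'x]; first by apply: Ns; rewrite inE bs orbT.
  have [b] := f's x f'x; rewrite inE => /predU1P[->|bs Lxb]; last by exists b.
  by move=> /f'a; rewrite mulgVK => /eqP; rewrite (negbTE f'x).
have sU' : subspace U'.
  split=> [|k u v [Uu us] [Uv vs]].
    by split=> [|x]; [exact: sU.1|rewrite eqxx].
  split=> [|x uvx]; first exact: sU.2.
  have [ux|/us//] := eqVneq (u x) 0; apply: vs; apply: contra uvx => /eqP vx.
  by apply/eqP; change (k *: u x + v x = 0); rewrite ux vx scaler0 addr0.
have eqU' u v : U' u -> U' v -> (forall x, L x -> u (x * a)%g = v (x * a)%g) -> u = v.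
  move=> U'u U'v uv; apply/eqP; rewrite -subr_eq0; apply/negPn/negP => uv_neq0.
  apply: noU'; exists (u - v); first exact: subspaceB.
  by split=> // x Lx; change (u (x * a)%g - v (x * a)%g = 0); rewrite uv// subrr.
have U'act l u : L l -> U' u -> U' (act l u).
  move=> Ll [Uu us]; split; first by apply: UN => //; exact: subgroup_normalizer.
  move=> x /= /us[b bs Lb]; exists b => //.
  have -> : (x * b^-1 = x * l * b^-1 * (l^-1 ^ b^-1))%g by rewrite /conjg !gnorm.
  by apply: subgroupM => //; apply: (Ns _ bs _).2; exact: subgroupV.
(* Restrictions of [U'] to [L a], shifted to [L]. As [a] normalizes [L], [T] is stable under [L], so
   [absL] puts every [delta v] in it. *)
pose T := [set m : M | (forall x, m x != 0 -> L x) /\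
  exists2 u, U' u & forall x, L x -> m x = u (x * a)%g].
have sT : subspace T.
  split=> [|k m m' [mL [u U'u mu]] [m'L [u' U'u' m'u']]].
    split=> [x|]; first by rewrite eqxx.
    by exists 0 => //; exact: sU'.1.
  split=> [x|].
    have [mx|/mL//] := eqVneq (m x) 0; change (k *: m x + m' x != 0 -> L x).
    by rewrite mx scaler0 add0r => /m'L.
  exists (k *: u + u'); first exact: sU'.2.
  by move=> x Lx; change (k *: m x + m' x = k *: u (x * a)%g + u' (x * a)%g);
    rewrite mu// m'u'.
have TL l : L l -> forall m, T m -> T (act l m).
  move=> Ll m [mL [u U'u mu]]; split=> [x /mL Lxl|].
    by rewrite -(mulgK l x); apply: subgroupM => //; exact: subgroupV.
  exists (act (l ^ a)%g u); first by apply: U'act => //; exact: (Na l).1.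
  by move=> x Lx /=; rewrite mu; [rewrite /conjg !gnorm|exact: subgroupM].
have T_neq0 : exists2 m, T m & m != 0 /\ forall x, m x != 0 -> L x.
  have [m mE] := restriction_exists (act a f) HL.
  have mL x : m x != 0 -> L x by rewrite mE; case: asboolP; rewrite ?eqxx.
  exists m.
    by split=> //; exists f; [split|move=> x Lx; rewrite mE; case: asboolP].
  split=> //; apply/eqP => m0; apply: noU'; exists f; first by split.
  split=> // x Lx; have := mE x; rewrite m0; case: asboolP => //= _.
have /choice[t tP] : forall v, exists u, U' u /\ forall x, L x -> delta v x = u (x * a)%g.
  by move=> v; have [_ [u U'u uE]] := absL T sT TL T_neq0 v; exists u.
have [|tau tauE] := @linear_exists K W M t.
  move=> k u v; apply: eqU'; [exact: (tP _).1|by apply: sU'.2; exact: (tP _).1|].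
  move=> x Lx; change (t (k *: u + v) (x * a)%g = k *: t u (x * a)%g + t v (x * a)%g).
  by rewrite -!(tP _).2// linearP.
pose phi : {linear W -> M} := act a \o tau.
have phiE v x : L x -> phi v x = delta v x by move=> Lx; rewrite (tP v).2//= tauE.
have phiH h : H h -> forall v, phi (rho h v) = act h (phi v).
  move=> Hh v; rewrite /phi /= tauE.
  suff -> : t (rho h v) = act (h ^ a)%g (t v) by rewrite -!act_comp /conjg mulgA mulgV mul1g.
  apply: eqU'; [exact: (tP _).1|apply: U'act; last exact: (tP _).1|].
    by apply: (Na h).1; exact: HL.
  move=> x Lx; rewrite -(tP _).2// delta_act//= (tP _).2;
    last by apply: subgroupM => //; exact: HL.
  by rewrite /conjg !gnorm.
suff -> : delta w = phi w.
  by rewrite /phi /= tauE; apply: UN => //; exact: (tP w).1.1.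
apply: ind_eq => x; have [Lx|nLx] := pselect (L x); first by rewrite phiE.
rewrite delta_notin; last by move/HL.
by apply/esym/eqP/negPn/negP => /(mackey_support phiH)/HL.
Qed.

(** If [L] contains a term of the lower central series, its normalizer contains the preceding term;
    so [c] normalizers lead from [H] to the whole group. *)
Lemma absorbing_setT : nilpotent_group G -> absorbing (subgroupT G).
Proof.
move=> [c Gc1].
have chain j : (j <= c)%N -> exists L, [/\ absorbing L, H `<=` L &
    lcs (subgroupT G) (c - j) `<=` L].
  elim: j => [_|j IH jc].
    exists H; split=> //; first exact: absorbing_base.
    by rewrite subn0 lcsT Gc1 => _ ->; exact: subgroup1.
  have [L [absL HL cL]] := IH (ltnW jc); exists (normalizer L); split.
  - exact: absorbing_normalizer.
  - by move=> x /HL; exact: subgroup_normalizer.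
  - move=> u cu l; rewrite -(subnSK jc) in cL.
    have cu' : lcs (subgroupT G) (c - j.+1) u^-1%g by exact: subgroupV.
    have ccR v k : lcs (subgroupT G) (c - j.+1) v -> L [~ k, v]%g.
      by move=> cv; apply: cL; exact: lcsRl.
    by split=> Ll; rewrite conjg_comm; apply: subgroupM => //; exact: ccR.
have [L [absL _]] := chain c (leqnn c); rewrite subnn => LT.
move=> U sU UG [f Uf [f_neq0 _]]; apply: absL => //.
  by move=> l _; exact: UG.
by exists f => //; split=> // x _; exact: LT.
Qed.

(** The translates of the [delta w] span: subtracting a translate of [delta (f a)] removes the coset
    of [a] from the support of [f]. *)
Lemma ind_irreducible (U : set M) : nilpotent_group G -> subspace U ->
  (forall g f, U f -> U (act g f)) -> (exists2 f, U f & f != 0) -> U = setT.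
Proof.
move=> nilG sU UG [f0 Uf0 f0_neq0].
have Ud : forall w, U (delta w).
  by apply: (absorbing_setT nilG) => // [g _|]; [exact: UG|exists f0].
apply/seteqP; split=> // f _; have [s] := ind_supp f.
elim: s f => [|a s IH] f fs.
  suff -> : f = 0 by exact: sU.1.
  by apply: ind_eq => x; apply/eqP/negPn/negP => /fs[].
rewrite -[f](subrK (act a^-1%g (delta (f a)))); apply: subspaceD => //; last exact: UG.
apply: IH => x.
change (f x - delta (f a) (x * a^-1)%g != 0 -> exists2 a0, a0 \in s & H (x * a0^-1)%g).
have [Hxa|nHxa] := pselect (H (x * a^-1)%g).
  by rewrite deltaH// -indH// mulgVK subrr eqxx.
rewrite delta_notin// subr0 => /fs[b]; rewrite inE => /predU1P[->//|bs].
by exists b.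
Qed.

End InducedIrreducible.

(** * Frobenius reciprocity *)

Section Frobenius.
Variables (G : groupType) (K : fieldType) (H : subgroup G) (V W : lmodType K).
Variables (pi : representation (subgroupT G) V) (rho : representation H W).
Variable f : {linear W -> V}.
Hypothesis fH : forall h, H h -> forall w, f (rho h w) = pi h (f w).
Implicit Types (m : ind_space rho) (g h x y : G).

(** [xget] depends only on the set [H x], so equal cosets get equal representatives; cosets being
    nonempty, the default is never reached. *)
Definition coset_repr x : G := xget 1%g (right_coset H x).

Lemma coset_reprP x : H (coset_repr x * x^-1)%g.
Proof.
rewrite /coset_repr; case: xgetP => [_ _ [h Hh <-]|/(_ x) []]; first by rewrite mulgK.
by exists 1%g; rewrite ?mul1g//; exact: subgroup1.
Qed.

Lemma coset_reprM h x : H h -> coset_repr (h * x)%g = coset_repr x.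
Proof.
move=> Hh; congr xget; apply/seteqP; split=> _ [k Hk <-].
  by exists (k * h)%g; [exact: subgroupM|rewrite mulgA].
by exists (k * h^-1)%g; [apply: subgroupM => //; exact: subgroupV|rewrite mulgA mulgVK].
Qed.

Lemma coset_repr_eq x y : H (x * y^-1)%g -> coset_repr x = coset_repr y.
Proof. by move=> /(coset_reprM y); rewrite mulgVK. Qed.

Lemma coset_repr_eqP x y : coset_repr x = coset_repr y -> H (x * y^-1)%g.
Proof.
move=> eqxy; have := subgroupM (subgroupV (coset_reprP x)) (coset_reprP y).
by rewrite eqxy !gnorm.
Qed.

Definition coset_term m x : V := pi x^-1%g (f (m x)).

Definition coset_reprs : set G := [set x | coset_repr x = x].

(** The homomorphism attached to [f] by reciprocity. Terms depend only on the coset ([coset_termM]),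
    and finitely many are nonzero. *)
Definition frobenius m : V := \sum_(x \in coset_reprs) coset_term m x.

Lemma coset_termM m h x : H h -> coset_term m (h * x)%g = coset_term m x.
Proof.
move=> Hh; rewrite /coset_term (indH m _ Hh) fH// -piM.
by rewrite invgM mulgVK.
Qed.

Lemma coset_repr_id x : coset_repr (coset_repr x) = coset_repr x.
Proof. by apply: coset_repr_eq; exact: coset_reprP. Qed.

Lemma frobeniusE m (s : seq G) : uniq s -> [set` s] `<=` coset_reprs ->
    (forall x, coset_reprs x -> m x != 0 -> x \in s) ->
  frobenius m = \sum_(x <- s) coset_term m x.
Proof.
move=> s_uniq s_repr ms; rewrite /frobenius (fsbigE s)//.
  rewrite [RHS]big_seq [LHS]big_seq_cond; apply: eq_bigl => x.
  by case xs: (x \in s) => //=; apply/mem_set/s_repr.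
move=> x xr xs; have [mx|/(ms x xr)] := eqVneq (m x) 0; last by rewrite (negbTE xs).
by rewrite /coset_term mx !linear0.
Qed.

Lemma coset_supp m : exists s : seq G, [/\ uniq s, [set` s] `<=` coset_reprs &
  forall x, coset_reprs x -> m x != 0 -> x \in s].
Proof.
have [s sP] := ind_supp m; exists (undup (map coset_repr s)); split.
- exact: undup_uniq.
- by move=> x /=; rewrite mem_undup => /mapP[y _ ->]; exact: coset_repr_id.
- move=> x xr /sP[a sa Hxa]; rewrite mem_undup; apply/mapP; exists a => //.
  by rewrite -{1}xr; exact: coset_repr_eq.
Qed.

Lemma frobenius_linear : linear frobenius.
Proof.
move=> k m m'; have [s [_ sr sP]] := coset_supp m;
  have [s' [_ s'r s'P]] := coset_supp m'.
have us : uniq (undup (s ++ s')) by exact: undup_uniq.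
have rs : [set` undup (s ++ s')] `<=` coset_reprs.
  by move=> x /=; rewrite mem_undup mem_cat => /orP[/sr|/s'r].
have ms x : coset_reprs x -> m x != 0 -> x \in undup (s ++ s').
  by move=> xr mx; rewrite mem_undup mem_cat sP.
have m's x : coset_reprs x -> m' x != 0 -> x \in undup (s ++ s').
  by move=> xr mx; rewrite mem_undup mem_cat s'P ?orbT.
rewrite (frobeniusE us rs ms) (frobeniusE us rs m's) (@frobeniusE _ (undup (s ++ s')))//.
  rewrite scaler_sumr -big_split; apply: eq_bigr => x _.
  rewrite /coset_term; change ((k *: m + m') x) with (k *: m x + m' x).
  by rewrite !linearP.
move=> x xr; have [mx|/(ms _ xr)//] := eqVneq (m x) 0.
change (k *: m x + m' x != 0 -> x \in undup (s ++ s')).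
by rewrite mx scaler0 add0r; exact: m's.
Qed.

Lemma frobenius_act g m : frobenius (ind_act g m) = pi g (frobenius m).
Proof.
have [s [us sr sP]] := coset_supp m.
(* Right translation by the inverse of [g] permutes cosets; [r] is its effect on representatives. *)
pose r x := coset_repr (x * g^-1)%g.
have Hr x : H (r x * g * x^-1)%g.
  by have := coset_reprP (x * g^-1)%g; rewrite !gnorm.
rewrite (frobeniusE us sr sP) (@frobeniusE _ (map r s)).
- rewrite big_map linear_sum; apply: eq_bigr => x _.
  rewrite -(coset_termM m x (Hr x)) mulgVK /coset_term /= -piM.
  by rewrite invgM mulVKg.
- rewrite map_inj_in_uniq// => x y /sr xr /sr yr rxy.
  rewrite -xr -yr; apply: coset_repr_eq; have := coset_repr_eqP rxy.
  by rewrite !gnorm.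
- by move=> x /= /mapP[y _ ->]; exact: coset_repr_id.
- move=> x xr /= mxg; apply/mapP; exists (coset_repr (x * g)%g).
    apply: sP; first exact: coset_repr_id.
    have := coset_reprP (x * g)%g; set h := (_ * _)%g => Hh.
    by rewrite -(mulgVK (x * g)%g (coset_repr _)) -/h indH// repr_act_eq0.
  rewrite -[LHS]xr; apply: coset_repr_eq.
  have := subgroupV (coset_reprP (x * g)%g); by rewrite !gnorm.
Qed.

End Frobenius.

(** [Phi] sends [delta rho w0] to the nonzero vector [f w0], so irreducibility on each side makes
    its kernel zero and its range everything. *)
Lemma irreducible_ind_isomorphic (G : groupType) (K : fieldType) (H : subgroup G)
    (V W : lmodType K) (pi : representation (subgroupT G) V)
    (rho : representation H W) (f : {linear W -> V}) :
    irreducible pi ->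
    (forall h, H h -> forall w, f (rho h w) = pi h (f w)) ->
    (exists w, f w != 0) ->
    (forall U : set (ind_space rho), subspace U ->
      (forall g m, U m -> U (ind_act g m)) -> (exists2 m, U m & m != 0) ->
      U = setT) ->
  isomorphic pi (ind rho).
Proof.
move=> [_ piU] fH [w0 fw0] indU.
have [Phi PhiE] := linear_exists (frobenius_linear pi f (rho := rho)).
have PhiG g m : Phi (ind_act g m) = pi g (Phi m) by rewrite PhiE frobenius_act.
have Phi_delta : Phi (delta rho w0) = f w0.
  have repr1 x : H x -> coset_repr H x = coset_repr H 1%g.
    by move=> Hx; apply: coset_repr_eq; rewrite invg1 mulg1.
  rewrite PhiE (@frobeniusE _ _ _ _ _ _ _ _ _ [:: coset_repr H 1%g])//.
  - rewrite big_seq1; have := coset_reprP H 1%g; set h := (_ * _)%g => Hh.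
    have -> : coset_repr H 1%g = (h * 1)%g by rewrite mulgVK.
    rewrite coset_termM// /coset_term invg1 repr_act1 deltaH ?repr_act1//.
    exact: subgroup1.
  - by move=> x /=; rewrite inE => /eqP ->; exact: coset_repr_id.
  - move=> x xr dx; rewrite inE -[x]xr; apply/eqP/repr1.
    by apply: contrapT => nHx; move: dx; rewrite delta_notin ?eqxx.
have sKer : subspace (Phi @^-1` [set 0]).
  by apply: subspace_preim; split=> // k u v -> ->; rewrite /mkset scaler0 addr0.
have Phi_inj : injective Phi.
  move=> m m' eqm; apply/eqP; rewrite -subr_eq0; apply/negPn/negP => mm'.
  case/eqP: fw0; rewrite -Phi_delta.
  suff : (Phi @^-1` [set 0]) (delta rho w0) by [].
  rewrite (indU _ sKer)// => [g u /= u0|].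
    by rewrite /preimage /= PhiG u0 linear0.
  by exists (m - m') => //; rewrite /preimage /= linearB /= eqm subrr.
have sRan : subspace (range Phi) by apply: subspace_image; split.
have Phi_surj v : exists m, Phi m = v.
  have [g _ _ [m _ <-]|R0|RT] := piU _ ((submod_closedP _).2 sRan).
  - by exists (ind_act g m).
  - by case/eqP: fw0; suff : [set 0] (f w0) by []; rewrite -R0; exists (delta rho w0).
  - by have [m _ <-] : range Phi v by [rewrite RT]; exists m.
have /choice[psi0 psi0P] := Phi_surj.
have [|psi psiE] := @linear_exists K V (ind_space rho) psi0.
  by move=> k u v; apply: Phi_inj; rewrite linearP !psi0P.
have psiK v : Phi (psi v) = v by rewrite psiE.
exists psi; first by exists Phi => // m; apply: Phi_inj; rewrite psiK.
by move=> g _ v; apply: Phi_inj; rewrite psiK PhiG psiK.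
Qed.

Theorem theoremB (G : groupType) (K : fieldType)
    (fgG : finitely_generated G) (nilG : nilpotent_group G)
    (V : lmodType K) (pi : representation (subgroupT G) V)
    (irr_pi : irreducible pi)
    (hyp : exists (H' : subgroup G) (W' : vectType K)
             (rho' : representation H' W'),
        [/\ irreducible rho',
            rep_hom rho' (restriction pi H') <> [set 0] &
            finite_dimensional (rep_hom rho' (restriction pi H'))]) :
  exists (H : subgroup G) (W : vectType K) (rho : representation H W),
    irreducible rho /\ isomorphic pi (ind rho).
Proof.
have noeth := fg_nilpotent_noetherian fgG nilG.
have [H admH maxH] := noetherian_max noeth (hyp : exists H, admissible pi H).
have [W [rho [f [irr_rho f_neq0 fH H_tors H_inertia]]]] :=
  admissible_max_normalizer admH maxH.
exists H, W, rho; split=> //.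
apply: (irreducible_ind_isomorphic irr_pi fH f_neq0) => U sU UG U_neq0.
apply: (ind_irreducible irr_rho) => //.
- by move=> x; exact: nilpotent_isolated.
- by move=> g; exact: noetherian_conj_normalizer.
Qed.
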